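(* Let $G$ be a connected, locally finite graph, let $\Gamma$ be a transitive nonunimodular subgroup of $\mathrm{Aut}(G)$, and let $w:\Omega\to[0,\infty)$ be a good weight function. Then the function $$\mathbb{R}\to(0,z_t(w)],\qquad\lambda\mapsto z_{c,\lambda}(w)$$ is continuous, and is strictly increasing on $(-\infty,1/2]$.
   Context: Let $G=(V,E)$ be a connected, locally finite graph with automorphism group $\mathrm{Aut}(G)$. A subgroup $\Gamma\subseteq \mathrm{Aut}(G)$ is transitive if for any $u,v\in V$ there is $\gamma\in\Gamma$ with $\gamma u=v$. The modular function $\Delta=\Delta_\Gamma:V^2\to(0,\infty)$ of a transitive subgroup $\Gamma$ is $\Delta(x,y)=|\mathrm{Stab}_y x|/|\mathrm{Stab}_x y|$, where $\mathrm{Stab}_x y$ is the orbit of $y$ under the stabilizer of $x$ in $\Gamma$. $\Gamma$ is unimodular if $\Delta\equiv 1$, and nonunimodular otherwise. Fix a root vertex $0\in V$. A path of length $n$ in $G$ is a sequence of vertices $\omega(0),\dots,\omega(n)$ together with, for each $0\le i<n$, an oriented edge from $\omega(i)$ to $\omega(i+1)$ (a multigraph homomorphism from the line graph with $n$ edges into $G$; vertices may be repeated). $\Omega$ is the set of all finite-length paths in $G$; $|\omega|$ is the length of $\omega$, $\omega^-,\omega^+$ are its first and last vertices, $\omega^\leftarrow$ its reversal. Paths $(\omega,\eta)$ are contiguous if $\omega^+=\eta^-$, in which case $\omega\circ\eta$ is their concatenation; a contiguous pair is disjoint if $\omega(i)\ne\eta(j)$ for every $i<|\omega|$ and $j>0$.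 A weight function $w:\Omega\to[0,\infty)$ is good if it is: $\Gamma$-invariant ($w(\gamma\omega)=w(\omega)$ for all $\gamma\in\Gamma$); reversible ($w(\omega)=w(\omega^\leftarrow)$); non-degenerate ($w(\omega)=1$ if $|\omega|=0$ and $w(\omega)\ge1$ if $|\omega|=1$); zero-range ($w(\omega\circ\eta)=w(\omega)w(\eta)$ for all contiguous disjoint pairs); and repulsive ($w(\omega\circ\eta)\le w(\omega)w(\eta)$ for all contiguous pairs). For $\lambda\in\mathbb{R}$, $n\ge0$, let $Z_w(\lambda;n)=\sum_{\omega\in\Omega:\,\omega^-=0,\,|\omega|=n}w(\omega)\Delta^\lambda(0,\omega^+)$. This is submultiplicative in $n$, so $\mu_{c,\lambda}(w)=\lim_{n\to\infty}Z_w(\lambda;n)^{1/n}=\inf_{n\ge1}Z_w(\lambda;n)^{1/n}$ is well defined; set $z_{c,\lambda}(w)=\mu_{c,\lambda}(w)^{-1}$ and $z_t(w)=z_{c,1/2}(w)$. *)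

(* Defs.v *)
From HB Require Import structures.
From mathcomp Require Import all_boot all_order all_algebra finmap.
From mathcomp Require Import all_classical all_reals all_analysis.

Set Implicit Arguments.
Unset Strict Implicit.
Unset Printing Implicit Defensive.

Import Order.TTheory GRing.Theory Num.Theory.
Import numFieldNormedType.Exports.

Local Open Scope classical_set_scope.
Local Open Scope ring_scope.

(* Multigraphs are given by their oriented edges, an unoriented edge being a
   pair {e, rev e}. Every non-loop edge has exactly two orientations. For loops,
   rev e = e is allowed, so that both usual conventions (a loop can be traversed
   in one or in two ways) are covered; simple graphs are a special case. *)
Record mgraph := MGraph {
  vert : choiceType ;
  edge : choiceType ;
  src : edge -> vert ;
  rev_edge : edge -> edge ;
  rev_edgeK : involutive rev_edge }.

Section Graph.
Variable G : mgraph.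
Implicit Types (x y : vert G) (e : edge G) (s : seq (edge G)).

Definition tgt e := src (rev_edge e).

Definition locally_finite := forall x, finite_set [set e | src e = x].

Lemma tgt_rev e : tgt (rev_edge e) = src e.
Proof. by rewrite /tgt rev_edgeK. Qed.

Fixpoint is_walk x s : bool :=
  if s is e :: s' then (src e == x) && is_walk (tgt e) s' else true.

(* A path of length n is its first vertex together with its n oriented edges;
   the other vertices are the endpoints of these edges. *)
Record gpath := GPath {
  pdata : vert G * seq (edge G) ;
  pdataP : is_walk pdata.1 pdata.2 }.

HB.instance Definition _ := [isSub for pdata].
HB.instance Definition _ := [Choice of gpath by <:].

Implicit Types om eta : gpath.

Definition pstart om : vert G := (pdata om).1.
Definition pedges om : seq (edge G) := (pdata om).2.
Definition plen om : nat := size (pedges om).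
Definition pend om : vert G := last (pstart om) (map tgt (pedges om)).

(* The vertex om(i), for i <= plen om. *)
Definition pvert om (i : nat) : vert G :=
  nth (pstart om) (pstart om :: map tgt (pedges om)) i.

Definition connected_graph :=
  forall x y, exists om, pstart om = x /\ pend om = y.

Lemma is_walk_cat x s1 s2 :
  is_walk x (s1 ++ s2) = is_walk x s1 && is_walk (last x (map tgt s1)) s2.
Proof. by elim: s1 x => //= e s1 IH x; rewrite IH andbA. Qed.

Lemma last_walk_rev x s : is_walk x s ->
  last (last x (map tgt s)) (map tgt (map (@rev_edge G) (rev s))) = x.
Proof.
case: s => //= e s /andP[/eqP <- _].
by rewrite rev_cons !map_rcons last_rcons tgt_rev.
Qed.

Lemma is_walk_rev x s : is_walk x s ->
  is_walk (last x (map tgt s)) (map (@rev_edge G) (rev s)).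
Proof.
elim: s x => //= e s IH x /andP[_ Hs].
rewrite rev_cons map_rcons -cats1 is_walk_cat IH //= andbT.
by rewrite last_walk_rev.
Qed.

Definition path_rev om : gpath :=
  @GPath (pend om, map (@rev_edge G) (rev (pedges om)))
    (is_walk_rev (pdataP om)).

Definition contiguous om eta := pend om = pstart eta.

Lemma path_cat_subproof om eta : contiguous om eta ->
  is_walk (pstart om) (pedges om ++ pedges eta).
Proof.
move=> c; rewrite is_walk_cat; apply/andP; split; first exact: pdataP.
by move: (pdataP eta); rewrite -/(pstart eta) -c.
Qed.

Definition path_cat om eta (c : contiguous om eta) : gpath :=
  @GPath (pstart om, pedges om ++ pedges eta) (path_cat_subproof c).

(* Meant for contiguous om and eta: the common vertex is not excluded. *)
Definition disjoint_paths om eta := forall i j : nat,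
  (i < plen om)%N -> (0 < j <= plen eta)%N -> pvert om i <> pvert eta j.

(* Automorphisms act on vertices and on oriented edges. *)
Record aut := Aut {
  avert : vert G -> vert G ;
  aedge : edge G -> edge G ;
  avert_inv : vert G -> vert G ;
  aedge_inv : edge G -> edge G ;
  avertK : cancel avert avert_inv ;
  avert_invK : cancel avert_inv avert ;
  aedgeK : cancel aedge aedge_inv ;
  aedge_invK : cancel aedge_inv aedge ;
  aut_src : forall e, src (aedge e) = avert (src e) ;
  aut_rev : forall e, rev_edge (aedge e) = aedge (rev_edge e) }.

Implicit Types g h k : aut.

Lemma autP g h : avert g = avert h -> aedge g = aedge h -> g = h.
Proof.
case: g => v e v' e' a1 a2 a3 a4 a5 a6; case: h => u f u' f' b1 b2 b3 b4 b5 b6.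
move=> /= ? ?; subst u f.
have ? : v' = u' by apply/funext => x; rewrite -{1}(b2 x) a1.
have ? : e' = f' by apply/funext => x; rewrite -{1}(b4 x) a3.
by subst u' f'; congr Aut; exact: Prop_irrelevance.
Qed.

HB.instance Definition _ := gen_eqMixin aut.
HB.instance Definition _ := gen_choiceMixin aut.

Definition aut1 : aut := @Aut id id id id
  (frefl _) (frefl _) (frefl _) (frefl _) (frefl _) (frefl _).

Definition aut_mul g h : aut.
Proof.
apply: (@Aut (avert g \o avert h) (aedge g \o aedge h)
             (avert_inv h \o avert_inv g) (aedge_inv h \o aedge_inv g)).
- by apply: can_comp; exact: avertK.
- by apply: can_comp; exact: avert_invK.
- by apply: can_comp; exact: aedgeK.
- by apply: can_comp; exact: aedge_invK.
- by move=> e; rewrite /= !aut_src.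
- by move=> e; rewrite /= !aut_rev.
Defined.

Definition aut_inv g : aut.
Proof.
apply: (@Aut (avert_inv g) (aedge_inv g) (avert g) (aedge g)).
- exact: avert_invK.
- exact: avertK.
- exact: aedge_invK.
- exact: aedgeK.
- by move=> e; apply: (can_inj (avertK g)); rewrite -aut_src aedge_invK avert_invK.
- by move=> e; apply: (can_inj (aedgeK g)); rewrite -aut_rev !aedge_invK.
Defined.

Lemma aut_mulA : associative aut_mul. Proof. by move=> g h k; exact: autP. Qed.
Lemma aut_mul1 : left_id aut1 aut_mul. Proof. by move=> g; exact: autP. Qed.
Lemma aut_1mul : right_id aut1 aut_mul. Proof. by move=> g; exact: autP. Qed.
Lemma aut_mulV : left_inverse aut1 aut_inv aut_mul.
Proof.
move=> g; apply: autP; apply/funext => z /=.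
- by rewrite avertK.
- by rewrite aedgeK.
Qed.
Lemma aut_Vmul : right_inverse aut1 aut_inv aut_mul.
Proof.
move=> g; apply: autP; apply/funext => z /=.
- by rewrite avert_invK.
- by rewrite aedge_invK.
Qed.

HB.instance Definition _ :=
  isGroup.Build aut aut_mulA aut_mul1 aut_1mul aut_mulV aut_Vmul.

Lemma is_walk_aut g x s : is_walk x s -> is_walk (avert g x) (map (aedge g) s).
Proof.
elim: s x => //= e s IH x /andP[/eqP <- Hs].
by rewrite aut_src eqxx /= /tgt aut_rev aut_src; exact: IH.
Qed.

Definition pact g om : gpath :=
  @GPath (avert g (pstart om), map (aedge g) (pedges om))
    (is_walk_aut g (pdataP om)).

Section Modular.
Variables (R : realType) (Gam : {pred aut}).

Definition transitive_aut :=
  forall x y, exists2 g, g \in Gam & avert g x = y.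

Definition stab_orbit x y : set (vert G) :=
  [set z | exists g, [/\ g \in Gam, avert g x = x & z = avert g y]].

(* For locally finite connected G, both orbits are finite; [fset_set] of a
   finite set is that set. *)
Definition modular x y : R :=
  #|` fset_set (stab_orbit y x)|%:R / #|` fset_set (stab_orbit x y)|%:R.

Definition unimodular := forall x y, modular x y = 1.

Record good_weight (w : gpath -> R) : Prop := GoodWeight {
  weight_ge0 : forall om, 0 <= w om ;
  weight_invariant : forall g, g \in Gam -> forall om, w (pact g om) = w om ;
  weight_reversible : forall om, w om = w (path_rev om) ;
  weight_length0 : forall om, plen om = 0%N -> w om = 1 ;
  weight_length1 : forall om, plen om = 1%N -> 1 <= w om ;
  weight_zero_range : forall om eta (c : contiguous om eta),
    disjoint_paths om eta -> w (path_cat c) = w om * w eta ;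
  weight_repulsive : forall om eta (c : contiguous om eta),
    w (path_cat c) <= w om * w eta }.

Variables (o : vert G) (w : gpath -> R).

Definition paths_from (n : nat) : set gpath :=
  [set om | pstart om = o /\ plen om = n].

Definition Zsum (lam : R) (n : nat) : R :=
  \sum_(om \in paths_from n) (w om * modular o (pend om) `^ lam).

(* By submultiplicativity, the limit exists and equals the infimum over
   n >= 1. *)
Definition mu_c (lam : R) : R :=
  limn (fun n : nat => Zsum lam n `^ n%:R^-1).

Definition z_c (lam : R) : R := (mu_c lam)^-1.

Definition z_t : R := z_c 2^-1.

End Modular.
End Graph.

(* Main.v *)
Require Import Defs.
From mathcomp Require Import all_boot all_order all_algebra finmap.
From mathcomp Require Import all_classical all_reals all_analysis.
From mathcomp Require Import lra ring zify.

Set Implicit Arguments.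
Unset Strict Implicit.
Unset Printing Implicit Defensive.

Import Order.TTheory GRing.Theory Num.Theory.
Import numFieldNormedType.Exports.
Local Open Scope classical_set_scope.
Local Open Scope ring_scope.

(** Let h be the logarithm of the modular function. The modular function is a
multiplicative cocycle, so h is additive along walks and Z(lam; n) is the sum
of w(s) exp(lam h(s)) over the walks s of length n started at the root. Write
mu(lam) for the growth rate of Z(lam; n).

Most of the theorem is soft. As w is repulsive, Z is submultiplicative and
Fekete's lemma ([submultiplicative_growth_rate]) makes mu(lam) both a limit and
an infimum. As |h(s)| <= M n on walks of length n, log mu is Lipschitz
([mu_lipschitz]), whence continuity. The mass-transport principle
([mass_transport]) gives Z(lam; n) = Z(1 - lam; n), so that convexity of the
exponential puts the minimum of mu at 1/2. The same convexity interpolates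
between lam and 1/2 ([mu_lt_interpolate]), which reduces strict monotonicity to
the strict inequality mu(1/2) < mu(lam) for lam < 1/2 ([mu_half_lt]).

That inequality is proved by contradiction. Suppose that c = 1/2 - lam > 0 and
that mu(lam) = mu(1/2); put z = 1 / mu(1/2). By symmetry mu(1/2 + c) and
mu(1/2 - c) both equal 1/z. Call a walk a bridge if its height stays above its
starting height and never exceeds its final height. The zero-range property
makes the weight multiplicative when bridges are concatenated, and a bridge is
a concatenation of irreducible bridges in exactly one way; so the generating
functions B and I of bridges and irreducible bridges satisfy the renewal
equation B = 1 + I B. With the tilt 1/2 + c, B converges below z, hence I <= 1
there, and also at z by continuity. Going back to the tilt 1/2 multiplies
each irreducible bridge by exp(- c h) < 1. So at the tilt 1/2 we get I < 1 and
B < oo at z itself ([critical_bridges_bounded]). The same holds for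
descending bridges, with the tilt 1/2 - c.

Now the argument of Hammersley and Welsh applies at z: a walk splits at its last
lowest point into two half-space walks, and a half-space walk splits into
alternately ascending and descending bridges of strictly decreasing height. The
total weight of half-space walks is thus at most the product of 1 + weight(b)
over all bridges b, which is finite ([half_space_bounded]). So the sum of
Z(1/2; n) z^n converges. But Z(1/2; n) >= mu(1/2)^n by submultiplicativity, so
all of its terms are at least 1. *)

(** * Enumerating walks *)

Section Walks.
Variable G : mgraph.
Implicit Types (x y : vert G) (e : edge G) (s : seq (edge G)).

Definition walk_end x s := last x (map (@tgt G) s).

Definition walk_rev s : seq (edge G) := map (@rev_edge G) (rev s).

Lemma walk_end_cat x s1 s2 :
  walk_end x (s1 ++ s2) = walk_end (walk_end x s1) s2.
Proof. by rewrite /walk_end map_cat last_cat. Qed.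

Lemma walk_revK : involutive walk_rev.
Proof.
move=> s; rewrite /walk_rev -map_rev revK -map_comp -[RHS]map_id.
by apply: eq_map => e /=; rewrite rev_edgeK.
Qed.

Lemma size_walk_rev s : size (walk_rev s) = size s.
Proof. by rewrite size_map size_rev. Qed.

Lemma walk_rev_cat s1 s2 : walk_rev (s1 ++ s2) = walk_rev s2 ++ walk_rev s1.
Proof. by rewrite /walk_rev rev_cat map_cat. Qed.

Lemma walk_end_rev x s : is_walk x s ->
  walk_end (walk_end x s) (walk_rev s) = x.
Proof. exact: last_walk_rev. Qed.

Lemma is_walk_walk_rev x s : is_walk x s ->
  is_walk (walk_end x s) (walk_rev s).
Proof. exact: is_walk_rev. Qed.

Lemma tgt_act (g : aut G) e : tgt (aedge g e) = avert g (tgt e).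
Proof. by rewrite /tgt aut_rev aut_src. Qed.

Lemma walk_end_act (g : aut G) x s :
  walk_end (avert g x) (map (aedge g) s) = avert g (walk_end x s).
Proof.
by rewrite /walk_end; elim: s x => //= e s IH x; rewrite tgt_act IH.
Qed.

Lemma avert_groupM (g h : aut G) x : avert (g * h)%g x = avert g (avert h x).
Proof. by []. Qed.
Lemma avert_groupV (g : aut G) x : avert g^-1%g x = avert_inv g x.
Proof. by []. Qed.
Hypothesis G_locfin : locally_finite G.

Definition out_edges x : seq (edge G) := fset_set [set e | src e = x].

Lemma mem_out_edges x e : (e \in out_edges x) = (src e == x).
Proof.
rewrite /out_edges in_fset_set; last exact: G_locfin.
by apply/idP/eqP; rewrite inE.
Qed.

Lemma out_edges_uniq x : uniq (out_edges x).
Proof. exact: fset_uniq. Qed.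

(** Walks from a fixed vertex are handled as bare lists of edges, so that cutting
and concatenating them are the list operations [take], [drop] and [++]. *)
Fixpoint walks x n : seq (seq (edge G)) :=
  if n is n'.+1 then
    flatten [seq [seq e :: s | s <- walks (tgt e) n'] | e <- out_edges x]
  else [:: [::]].

Lemma mem_walks x n s : (s \in walks x n) = is_walk x s && (size s == n).
Proof.
elim: n x s => [|n IH] x s /=.
  by case: s => [|e s] //=; rewrite inE andbF.
apply/flatten_mapP/idP => [[e]|].
  rewrite mem_out_edges => /eqP <- /mapP[s' + ->].
  by rewrite IH /= eqxx eqSS.
case: s => [|e s] //=; rewrite eqSS => /andP[/andP[ex ws] ss].
exists e; first by rewrite mem_out_edges.
by apply/mapP; exists s => //; rewrite IH ws.
Qed.

Lemma walks_uniq x n : uniq (walks x n).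
Proof.
elim: n x => [|n IH] x //=.
have := out_edges_uniq x; elim: (out_edges x) => //= e es IHes /andP[ees ues].
rewrite cat_uniq IHes // andbT; apply/andP; split.
  by rewrite map_inj_uniq // => s1 s2 [].
apply/hasPn => s /flatten_mapP[e' e'es /mapP[s' _ ->]].
apply/mapP => -[s'' _ [ee _]]; move: ees; by rewrite -ee e'es.
Qed.

Section Sums.
Variable R : realType.

Lemma sum_walks0 x (f : seq (edge G) -> R) :
  \sum_(s <- walks x 0) f s = f [::].
Proof. by rewrite /= big_seq1. Qed.

Lemma sum_walksS x n (f : seq (edge G) -> R) :
  \sum_(s <- walks x n.+1) f s =
  \sum_(e <- out_edges x) \sum_(s <- walks (tgt e) n) f (e :: s).
Proof.
by rewrite /= big_flatten /= big_map; apply: eq_bigr => e _; rewrite big_map.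
Qed.

Lemma sum_walks_cat x k l (f : seq (edge G) -> R) :
  \sum_(s <- walks x (k + l)) f s =
  \sum_(s1 <- walks x k) \sum_(s2 <- walks (walk_end x s1) l) f (s1 ++ s2).
Proof.
elim: k x f => [|k IH] x f; first by rewrite sum_walks0.
rewrite addSn !sum_walksS; apply: eq_bigr => e _.
by rewrite IH.
Qed.

Lemma sum_walks_act (g : aut G) x n (f : seq (edge G) -> R) :
  \sum_(s <- walks (avert g x) n) f s =
  \sum_(s <- walks x n) f (map (aedge g) s).
Proof.
rewrite -(big_map (map (aedge g)) xpredT f); apply: perm_big.
have gK h : cancel (map (@aedge G h)) (map (aedge_inv h)).
  by move=> s; rewrite -map_comp -[RHS]map_id; apply: eq_map => e /=; rewrite aedgeK.
apply: uniq_perm; first exact: walks_uniq.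
  by rewrite map_inj_uniq ?walks_uniq//; exact: can_inj (gK g).
move=> s; rewrite mem_walks; apply/idP/mapP => [/andP[ws ss]|[s' + ->]].
  exists (map (aedge_inv g) s).
    rewrite mem_walks size_map ss andbT.
    by have := is_walk_aut (aut_inv g) ws; rewrite /= avertK.
  rewrite -map_comp -[LHS]map_id; apply: eq_map => e /=.
  by rewrite aedge_invK.
by rewrite mem_walks size_map => /andP[ws ->]; rewrite is_walk_aut.
Qed.

(** Reversal exchanges the walks from x to y and those from y to x. *)
Lemma sum_walks_rev x y n (f : seq (edge G) -> R) :
  \sum_(s <- walks x n | walk_end x s == y) f s =
  \sum_(s <- walks y n | walk_end y s == x) f (walk_rev s).
Proof.
rewrite -big_filter -[RHS]big_filter -(big_map walk_rev xpredT f).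
apply: perm_big; apply: uniq_perm.
- by rewrite filter_uniq ?walks_uniq.
- rewrite map_inj_uniq; last exact: can_inj walk_revK.
  by rewrite filter_uniq ?walks_uniq.
have aux u v s : (s \in [seq s <- walks u n | walk_end u s == v]) ->
    walk_rev s \in [seq s <- walks v n | walk_end v s == u].
  rewrite !mem_filter !mem_walks size_walk_rev => /and3P[/eqP <- ws ->].
  by rewrite walk_end_rev// eqxx is_walk_walk_rev.
move=> s; apply/idP/mapP => [/aux sP|[s' /aux sP ->]].
  by exists (walk_rev s); rewrite // walk_revK.
by exact: sP.
Qed.

End Sums.
End Walks.

(** * The modular function and mass transport *)

Section Counting.
Local Open Scope nat_scope.

Definition ncard (T : choiceType) (A : set T) : nat := #|` fset_set A|.

Lemma ncard_image (T U : choiceType) (f : T -> U) (A : set T) :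
  injective f -> finite_set A -> ncard (f @` A) = ncard A.
Proof. by move=> fI Afin; rewrite /ncard fset_set_image// card_imfset. Qed.

Lemma ncard_gt0 (T : choiceType) (A : set T) x :
  finite_set A -> A x -> 0 < ncard A.
Proof.
move=> Afin Ax; rewrite /ncard cardfs_gt0; apply/fset0Pn; exists x.
by rewrite in_fset_set// inE.
Qed.

Lemma sum1_ncard (T : choiceType) (s : seq T) (P : T -> Prop) (A : set T) :
  uniq s -> finite_set A -> (forall x, A x <-> x \in s /\ P x) ->
  \sum_(x <- s | `[< P x >]) 1 = ncard A.
Proof.
move=> us Afin AP; rewrite sum1_count -size_filter /ncard.
apply: perm_size; apply: uniq_perm; rewrite ?filter_uniq ?fset_uniq// => x.
rewrite mem_filter in_fset_set//; apply/andP/idP => [[/asboolP Px xs]|].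
  by rewrite inE AP.
by rewrite inE AP => -[-> Px]; split => //; apply/asboolP.
Qed.

(** Both sides count the pairs (x, y) of A * B that are related by Q. *)
Lemma double_count (T U : choiceType) (A : set T) (B : set U)
    (Q : T -> U -> Prop) (m n : nat) :
  finite_set A -> finite_set B ->
  (forall x, A x -> ncard [set y | B y /\ Q x y] = m) ->
  (forall y, B y -> ncard [set x | A x /\ Q x y] = n) ->
  ncard A * m = ncard B * n.
Proof.
move=> Afin Bfin Am Bn.
have aux (V W : choiceType) (C : set V) (E : set W) (S : V -> W -> Prop) k :
    finite_set C -> finite_set E ->
    (forall x, C x -> ncard [set y | E y /\ S x y] = k) ->
    \sum_(x <- fset_set C) \sum_(y <- fset_set E | `[< S x y >]) 1 = ncard C * k.
  move=> Cfin Efin Ck.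
  rewrite (eq_big_seq (fun=> k)) => [|x]; last first.
    rewrite in_fset_set// inE => Cx; rewrite -(Ck x Cx); apply: sum1_ncard => //.
      by apply: sub_finite_set Efin => y [].
    by move=> y /=; rewrite in_fset_set// inE.
  by rewrite big_const_seq count_predT iter_addn_0 mulnC.
rewrite -(aux _ _ _ _ _ _ Afin Bfin Am).
rewrite -(aux _ _ _ _ (fun y x => Q x y) _ Bfin Afin Bn).
by rewrite (exchange_big_dep xpredT).
Qed.

End Counting.

Section Orbits.
Variables (G : mgraph).
Implicit Types (x y z : vert G) (g h : aut G) (H : set (aut G)).

Definition subgroup_set H :=
  [/\ H 1%g, forall g h, H g -> H h -> H (g * h)%g & forall g, H g -> H g^-1%g].

Definition orbit_set H y : set (vert G) := [set avert g y | g in H].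

Definition stab H x : set (aut G) := [set g | H g /\ avert g x = x].

Lemma avert_injective g : injective (avert g).
Proof. exact: can_inj (avertK g). Qed.

Lemma stab_subgroup H x : subgroup_set H -> subgroup_set (stab H x).
Proof.
move=> [H1 HM HV]; split=> [|g h [Hg gx] [Hh hx]|g [Hg gx]]; split => //.
- exact: HM.
- by rewrite avert_groupM hx.
- exact: HV.
- by rewrite avert_groupV -[in LHS]gx avertK.
Qed.

(** The left-hand side is the fibre over g y of the orbit of the pair (y, z)
under H; it is a translate of the fibre over y, on which only the stabilizer of
y acts. *)
Lemma orbit_fibre H y z g : subgroup_set H -> H g ->
  [set z' | orbit_set H z z' /\
            exists2 h, H h & avert h y = avert g y /\ avert h z = z'] =
  avert g @` orbit_set (stab H y) z.
Proof.
move=> [H1 HM HV] Hg; apply/seteqP; split=> z'.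
  move=> [_ [h Hh [hy <-]]]; exists (avert (g^-1 * h)%g z).
    exists (g^-1 * h)%g => //; split; first by apply: HM => //; exact: HV.
    by rewrite avert_groupM hy avert_groupV avertK.
  by rewrite avert_groupM avert_groupV avert_invK.
move=> [_ [h [Hh hy] <-] <-]; split.
  by exists (g * h)%g => //; exact: HM.
by exists (g * h)%g; [exact: HM|rewrite !avert_groupM hy].
Qed.

(** Both sides are the size of the orbit of the pair (y, z), computed by
projecting it to either coordinate. *)
Lemma orbit_stab_swap H y z : subgroup_set H ->
  finite_set (orbit_set H y) -> finite_set (orbit_set H z) ->
  (ncard (orbit_set H y) * ncard (orbit_set (stab H y) z) =
   ncard (orbit_set H z) * ncard (orbit_set (stab H z) y))%N.
Proof.
move=> Hs yfin zfin.
have sfin u v : finite_set (orbit_set H v) ->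
    finite_set (orbit_set (stab H u) v).
  by apply: sub_finite_set => t [g [Hg _] <-]; exists g.
apply: (@double_count _ _ _ _
  (fun y' z' => exists2 h, H h & avert h y = y' /\ avert h z = z')) => //.
  move=> _ [g Hg <-]; rewrite orbit_fibre// ncard_image//; last exact: sfin.
  exact: avert_injective.
move=> _ [g Hg <-]; rewrite -(ncard_image (@avert_injective g) (sfin z y yfin)).
rewrite -orbit_fibre//; congr ncard; apply/seteqP; split => y' [Oy [h Hh [h1 h2]]];
  by split => //; exists h.
Qed.

End Orbits.

Section Modular.
Variables (R : realType) (G : mgraph).
Hypotheses (G_connected : connected_graph G) (G_locfin : locally_finite G).
Variable Gam : {pred aut G}.
Hypotheses (Gam_subgroup : group_closed Gam) (Gam_transitive : transitive_aut Gam).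
Implicit Types (x y z : vert G) (g h : aut G).

Local Notation D := (modular R Gam).
Local Notation Gs := [set g | g \in Gam].

Lemma Gam_subgroup_set : subgroup_set Gs.
Proof.
case: Gam_subgroup => G1 GD.
have GV g : g \in Gam -> (g^-1)%g \in Gam.
  by move=> gG; rewrite -div1g; exact: GD.
split => //= g h gG hG.
by rewrite -[h]invgK; apply: GD => //; exact: GV.
Qed.

Lemma Gam_V g : g \in Gam -> (g^-1)%g \in Gam.
Proof. by case: Gam_subgroup_set => _ _; exact. Qed.

Lemma stab_orbitE x y : stab_orbit Gam x y = orbit_set (stab Gs x) y.
Proof.
apply/seteqP; split=> z /= => [[g [gG gx ->]]|[g [gG gx] <-]]; first by exists g.
by exists g.
Qed.

Lemma connecting_walk x y : exists s, is_walk x s /\ walk_end x s = y.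
Proof.
have [[[x' s] /= ws] [<- <-]] := G_connected x y.
by exists s.
Qed.

Lemma finite_walk_ends x n : finite_set [set y | exists s, s \in walks x n /\ walk_end x s = y].
Proof.
apply: (@sub_finite_set _ _ [set` map (walk_end x) (walks x n)]).
  by move=> y [s [sW <-]] /=; apply: map_f.
exact: finite_seq.
Qed.

(** An automorphism that fixes x preserves the length of walks from x, and only
finitely many vertices end a walk of given length. *)
Lemma finite_stab_orbit x y : finite_set (stab_orbit Gam x y).
Proof.
have [s [ws es]] := connecting_walk x y.
apply: sub_finite_set (finite_walk_ends x (size s)) => z [g [gG gx ->]].
exists (map (aedge g) s); split.
  by rewrite (mem_walks G_locfin) size_map eqxx andbT -{1}gx is_walk_aut.
by rewrite -{1}gx walk_end_act es.
Qed.

Lemma stab_orbit_refl x y : stab_orbit Gam x y y.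
Proof. by exists 1%g; split => //; case: Gam_subgroup_set. Qed.

Lemma card_stab_orbit_gt0 x y : (0 < ncard (stab_orbit Gam x y))%N.
Proof.
exact: ncard_gt0 (finite_stab_orbit x y) (stab_orbit_refl x y).
Qed.

Lemma card_stab_orbit_act g x y : g \in Gam ->
  ncard (stab_orbit Gam (avert g x) (avert g y)) = ncard (stab_orbit Gam x y).
Proof.
move=> gG; rewrite -[RHS](ncard_image (@avert_injective _ g) (finite_stab_orbit x y)).
case: Gam_subgroup_set => _ GM GV.
congr ncard; apply/seteqP; split=> z.
  move=> [h [hG hx ->]]; exists (avert (g^-1 * h * g)%g y).
    exists (g^-1 * h * g)%g; split => //.
      by apply: (GM) => //; apply: (GM) => //; exact: GV.
    by rewrite !avert_groupM hx avert_groupV avertK.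
  by rewrite !avert_groupM avert_groupV avert_invK.
move=> [_ [h [hG hx ->]] <-]; exists (g * h * g^-1)%g; split.
- by apply: (GM); [exact: GM|exact: GV].
- by rewrite !avert_groupM avert_groupV avertK hx.
- by rewrite !avert_groupM avert_groupV avertK.
Qed.

Lemma modularE x y :
  D x y = (ncard (stab_orbit Gam y x))%:R / (ncard (stab_orbit Gam x y))%:R.
Proof. by []. Qed.

Lemma card_stab_orbit_neq0 x y : (ncard (stab_orbit Gam x y))%:R != 0 :> R.
Proof. by rewrite pnatr_eq0 -lt0n card_stab_orbit_gt0. Qed.

Lemma modular_gt0 x y : 0 < D x y.
Proof. by rewrite modularE divr_gt0// ltr0n card_stab_orbit_gt0. Qed.

Lemma modular_act g x y : g \in Gam -> D (avert g x) (avert g y) = D x y.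
Proof. by move=> gG; rewrite !modularE !card_stab_orbit_act. Qed.

Lemma modular_inv x y : D y x = (D x y)^-1.
Proof. by rewrite !modularE invf_div. Qed.

(** The identity |H y| |H_y z| = |H z| |H_z y|, with H the stabilizer of each of
x, y and z in turn, yields three relations between the six orbits involved;
dividing them leaves the cocycle identity. *)
Lemma modularM x y z : D x y * D y z = D x z.
Proof.
have sw u v t : (ncard (stab_orbit Gam u v) * ncard (orbit_set (stab (stab Gs u) v) t) =
    ncard (stab_orbit Gam u t) * ncard (orbit_set (stab (stab Gs u) t) v))%N.
  rewrite !stab_orbitE; apply: orbit_stab_swap; rewrite -?stab_orbitE.
  - exact/stab_subgroup/Gam_subgroup_set.
  - exact: finite_stab_orbit.
  - exact: finite_stab_orbit.
have stabC u v : stab (stab Gs u) v = stab (stab Gs v) u.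
  by apply/seteqP; split => g [[? ?] ?].
have orb_gt0 u v t : (0 < ncard (orbit_set (stab (stab Gs u) v) t))%N.
  apply: (@ncard_gt0 _ _ t).
    apply: sub_finite_set (finite_stab_orbit u t).
    by rewrite stab_orbitE => _ [g [gu _] <-]; exists g.
  exists 1%g => //; by case: (stab_subgroup v (stab_subgroup u Gam_subgroup_set)).
have e1 := sw x y z; have e2 := sw y x z; have e3 := sw z x y.
rewrite (stabC y x) in e2; rewrite (stabC z x) (stabC z y) in e3.
move/(congr1 (fun n : nat => n%:R : R)): e1.
move/(congr1 (fun n : nat => n%:R : R)): e2.
move/(congr1 (fun n : nat => n%:R : R)): e3.
rewrite !natrM !modularE.
have := card_stab_orbit_neq0 x y; have := card_stab_orbit_neq0 y x.
have := card_stab_orbit_neq0 x z; have := card_stab_orbit_neq0 z x.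
have := card_stab_orbit_neq0 y z; have := card_stab_orbit_neq0 z y.
have nz u v t : (ncard (orbit_set (stab (stab Gs u) v) t))%:R != 0 :> R.
  by rewrite pnatr_eq0 -lt0n.
have := nz x y z; have := nz x z y; have := nz y z x.
move: (ncard (orbit_set _ z))%:R (ncard (orbit_set _ y))%:R
  (ncard (orbit_set _ x))%:R => a b c.
move: (ncard (stab_orbit Gam x y))%:R (ncard (stab_orbit Gam y x))%:R
  (ncard (stab_orbit Gam x z))%:R (ncard (stab_orbit Gam z x))%:R
  (ncard (stab_orbit Gam y z))%:R (ncard (stab_orbit Gam z y))%:R.
move=> xy yx xz zx yz zy c0 b0 a0 zy0 yz0 zx0 xz0 yx0 xy0 e3 e2 e1.
have -> : xy = xz * b / a by rewrite -e1 mulfK.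
have -> : yx = yz * c / a by rewrite -e2 mulfK.
have -> : zx = zy * c / b by rewrite -e3 mulfK.
by field; rewrite ?(a0, b0, c0, xz0, yz0, zy0).
Qed.

Lemma modular_refl x : D x x = 1.
Proof. by rewrite modularE divff// card_stab_orbit_neq0. Qed.

(** For unimodular groups the mass sent out of a vertex equals the mass that it
receives; in general the received mass is reweighted by the modular function. The
proof is a double count. Relate y to y' when some group element carries (y, o) to
(o, y'): then as much mass goes from o to y as from y' to o, the relation is
symmetric, and the number of partners of y is the size of a stabilizer orbit. *)
Lemma mass_transport o n (f : vert G -> seq (edge G) -> R) :
  (forall g, g \in Gam -> forall x s, f (avert g x) (map (aedge g) s) = f x s) ->
  \sum_(s <- walks o n) f o s =
  \sum_(s <- walks o n) f (walk_end o s) (walk_rev s) * D o (walk_end o s).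
Proof.
move=> finv.
pose F x y := \sum_(s <- walks x n | walk_end x s == y) f x s.
have Finv g x y : g \in Gam -> F (avert g x) (avert g y) = F x y.
  move=> gG; rewrite /F big_mkcond (sum_walks_act G_locfin) [RHS]big_mkcond.
  apply: eq_bigr => s _; rewrite walk_end_act (inj_eq (@avert_injective _ g)).
  by rewrite finv.
pose B := undup (map (walk_end o) (walks o n)).
have memB y : reflect (exists2 s, is_walk o s /\ size s = n & walk_end o s = y) (y \in B).
  rewrite /B mem_undup; apply: (iffP mapP) => [[s + ->]|[s [ws ss] <-]].
    by rewrite (mem_walks G_locfin) => /andP[ws /eqP ss]; exists s.
  by exists s; rewrite // (mem_walks G_locfin) ws ss eqxx.
have BE (ff : vert G -> seq (edge G) -> R) :
    \sum_(s <- walks o n) ff (walk_end o s) s =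
    \sum_(y <- B) \sum_(s <- walks o n | walk_end o s == y) ff y s.
  rewrite (exchange_big_dep xpredT)//=; apply: eq_big_seq => s sW.
  rewrite -big_filter (_ : [seq _ <- _ | _] = [:: walk_end o s]) ?big_seq1//.
  rewrite -(filter_pred1_uniq (undup_uniq _) (_ : walk_end o s \in B)).
    by apply: eq_filter => y /=; rewrite [RHS]eq_sym.
  by rewrite mem_undup; apply: map_f.
pose Q y y' := exists g, [/\ g \in Gam, avert g y = o & avert g o = y'].
have Qsym y y' : Q y y' -> Q y' y.
  move=> [g [gG gy go]]; exists (g^-1)%g; split; first exact: Gam_V.
  - by rewrite avert_groupV -go avertK.
  - by rewrite avert_groupV -gy avertK.
have QB y y' : Q y y' -> y \in B -> y' \in B.
  move=> [g [gG gy go]] /memB[s [ws ss] es]; apply/memB.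
  have ws' : is_walk y' (map (aedge g) s) by rewrite -go is_walk_aut.
  have es' : walk_end y' (map (aedge g) s) = o by rewrite -go walk_end_act es gy.
  exists (walk_rev (map (aedge g) s)); last by rewrite -[X in walk_end X]es' walk_end_rev.
  by rewrite -[X in is_walk X]es' is_walk_walk_rev// size_walk_rev size_map.
have Qcard y : y \in B ->
    (\sum_(y' <- B | `[< Q y y' >]) 1 = ncard (stab_orbit Gam y o))%N.
  move=> yB; have [g gG gy] := Gam_transitive y o.
  rewrite -(ncard_image (@avert_injective _ g) (finite_stab_orbit y o)).
  apply: sum1_ncard; first exact: undup_uniq.
    exact/finite_image/finite_stab_orbit.
  case: Gam_subgroup_set => _ GM GV.
  move=> y'; split=> [[_ [h [hG hy ->]] <-]|[y'B [h [hG hy ho]]]].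
    have Qy : Q y (avert g (avert h o)).
      exists (g * h)%g; split => //; first exact: GM.
      by rewrite avert_groupM hy.
    by split => //; exact: QB Qy yB.
  exists (avert (g^-1 * h)%g o); last by rewrite avert_groupM avert_groupV avert_invK.
  exists (g^-1 * h)%g; split => //; first by apply: GM => //; exact: GV.
  by rewrite avert_groupM hy -gy avert_groupV avertK.
have QF y y' : Q y y' -> F o y = F y' o.
  by move=> [g [gG gy go]]; rewrite -(Finv g) // gy go.
have Qa y y' : Q y y' -> ncard (stab_orbit Gam y o) = ncard (stab_orbit Gam o y').
  by move=> [g [gG gy go]]; rewrite -(card_stab_orbit_act y o gG) gy go.
pose a y : R := (ncard (stab_orbit Gam y o))%:R.
have a_neq0 y : a y != 0 by exact: card_stab_orbit_neq0.
transitivity (\sum_(y <- B) F o y).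
  by rewrite (BE (fun _ s => f o s)).
transitivity (\sum_(y <- B) \sum_(y' <- B | `[< Q y y' >]) F o y / a y).
  apply: eq_big_seq => y yB; rewrite big_const_seq iter_addr_0 -sum1_count Qcard//.
  by rewrite -mulr_natr divfK// a_neq0.
transitivity (\sum_(y' <- B) \sum_(y <- B | `[< Q y' y >]) F y' o / (ncard (stab_orbit Gam o y'))%:R).
  rewrite (exchange_big_dep xpredT)//=; apply: eq_bigr => y' _.
  apply: eq_big => [y|y /asboolP Qy].
    by apply/asboolP/asboolP; exact: Qsym.
  by rewrite (QF _ _ Qy) /a (Qa _ _ Qy).
transitivity (\sum_(y <- B) F y o * D o y).
  apply: eq_big_seq => y yB; rewrite big_const_seq iter_addr_0 -sum1_count Qcard//.
  by rewrite -[LHS]mulr_natr modularE mulrAC mulrA.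
rewrite (BE (fun y s => f y (walk_rev s) * D o y)).
apply: eq_bigr => y _; rewrite mulr_suml.
rewrite (eq_bigr (fun s => f y s * D o y)) // (sum_walks_rev G_locfin).
by apply: eq_bigr => s; rewrite walk_revK.
Qed.

End Modular.

(** * Heights and tilted weights *)

Section Heights.
Variables (R : realType) (G : mgraph).
Hypotheses (G_connected : connected_graph G) (G_locfin : locally_finite G).
Variable Gam : {pred aut G}.
Hypotheses (Gam_subgroup : group_closed Gam) (Gam_transitive : transitive_aut Gam).
Variables (o : vert G) (w : gpath G -> R).
Hypothesis w_good : good_weight Gam w.
Implicit Types (x y z : vert G) (g h : aut G) (e : edge G) (s : seq (edge G)).

Local Notation D := (modular R Gam).

(** Working with logarithms turns the cocycle identity into additivity, and
makes the height of a walk depend on its list of edges only. *)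
Definition edge_height e : R := ln (D (src e) (tgt e)).

Definition height s : R := \sum_(e <- s) edge_height e.

Lemma height_nil : height [::] = 0. Proof. by rewrite /height big_nil. Qed.

Lemma height_cons e s : height (e :: s) = edge_height e + height s.
Proof. by rewrite /height big_cons. Qed.

Lemma height1 e : height [:: e] = edge_height e.
Proof. by rewrite height_cons height_nil addr0. Qed.

Lemma height_cat s1 s2 : height (s1 ++ s2) = height s1 + height s2.
Proof. by rewrite /height big_cat. Qed.

Lemma edge_height_rev e : edge_height (rev_edge e) = - edge_height e.
Proof.
rewrite /edge_height /tgt rev_edgeK modular_inv lnV// posrE.
exact: modular_gt0.
Qed.

Lemma height_walk_rev s : height (walk_rev s) = - height s.
Proof.
elim: s => [|e s IH]; first by rewrite /walk_rev /= height_nil oppr0.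
rewrite -cat1s walk_rev_cat !height_cat IH /walk_rev /= !height1.
by rewrite edge_height_rev opprD addrC.
Qed.

Lemma edge_height_act g e : g \in Gam -> edge_height (aedge g e) = edge_height e.
Proof.
move=> gG; rewrite /edge_height aut_src tgt_act.
by rewrite modular_act.
Qed.

Lemma height_act g s : g \in Gam -> height (map (aedge g) s) = height s.
Proof.
move=> gG; rewrite /height big_map; apply: eq_bigr => e _.
exact: edge_height_act.
Qed.

Lemma expR_height x s : is_walk x s -> expR (height s) = D x (walk_end x s).
Proof.
elim: s x => [|e s IH] x /=; first by rewrite height_nil expR0 modular_refl.
move=> /andP[/eqP <- ws]; rewrite height_cons expRD (IH _ ws) /edge_height.
rewrite lnK ?posrE; last exact: modular_gt0.
exact: modularM.
Qed.

Lemma walk_height_eq x s1 s2 : is_walk x s1 -> is_walk x s2 ->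
  walk_end x s1 = walk_end x s2 -> height s1 = height s2.
Proof.
by move=> w1 w2 e12; apply: expR_inj; rewrite !(@expR_height x) ?e12.
Qed.

(** Transitivity leaves only the finitely many edges at o to be bounded. *)
Lemma height_le_size : exists2 M : R, 0 <= M &
  forall x s, is_walk x s -> `|height s| <= M * (size s)%:R.
Proof.
exists (\sum_(e <- out_edges o) `|edge_height e|); first exact: sumr_ge0.
move=> x s; elim: s x => [|e s IH] x /=; first by rewrite height_nil normr0 mulr0.
move=> /andP[/eqP ex ws]; rewrite height_cons -natr1 mulrDr mulr1 addrC.
apply: (le_trans (ler_normD _ _)); apply: lerD; first exact: IH ws.
have [g gG gx] := Gam_transitive x o.
rewrite -(edge_height_act e gG) (big_rem (aedge g e)) /=.
  by rewrite lerDl sumr_ge0.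
by rewrite mem_out_edges// aut_src ex gx.
Qed.

Hypothesis Gam_nonunimodular : ~ unimodular R Gam.

(** Were every edge horizontal, connectedness would force the modular function
to be identically 1. The sign of c chooses between ascending and descending
edges, a descending edge being the reversal of an ascending one. *)
Lemma exists_sloped_edge (c : R) : c != 0 ->
  exists2 e, src e = o & 0 < c * edge_height e.
Proof.
move=> c0; have [e he] : exists e, edge_height e != 0.
  apply: contrapT => noe; apply: Gam_nonunimodular => x y.
  have [s [ws <-]] := connecting_walk G_connected x y.
  rewrite -(expR_height ws) /height big1 ?expR0// => e _.
  by apply/eqP/negPn/negP => he; apply: noe; exists e.
have [e' he'] : exists e', 0 < c * edge_height e'.
  have [lt0|gt0|] := ltgtP (c * edge_height e) 0; last 2 first.
  - by exists e.
  - by move/eqP; rewrite mulf_eq0 (negbTE c0) (negbTE he).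
  by exists (rev_edge e); rewrite edge_height_rev mulrN oppr_gt0.
have [g gG gx] := Gam_transitive (src e') o.
by exists (aedge g e'); rewrite ?aut_src// edge_height_act.
Qed.

(** Totalized by 0, so that sums can range over plain lists of edges. *)
Definition walk_weight x s : R := if insub (x, s) is Some om then w om else 0.

Lemma walk_weight_gpath (om : gpath G) : walk_weight (pstart om) (pedges om) = w om.
Proof. by rewrite /walk_weight /pstart /pedges -surjective_pairing valK. Qed.

Lemma walk_weight_walk x s (ws : is_walk x s) : walk_weight x s = w (@GPath G (x, s) ws).
Proof. by rewrite -[RHS]walk_weight_gpath. Qed.

Lemma walk_weight_ge0 x s : 0 <= walk_weight x s.
Proof. by rewrite /walk_weight; case: insub => // om; exact: weight_ge0 w_good om. Qed.

Lemma walk_weight_act g x s : g \in Gam -> walk_weight (avert g x) (map (aedge g) s) = walk_weight x s.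
Proof.
move=> gG; case/boolP: (is_walk x s) => ws.
  rewrite (walk_weight_walk ws) -(weight_invariant w_good gG) -walk_weight_gpath.
  by [].
rewrite /walk_weight [in RHS]insubN//= insubN//=; apply: contra ws => /(is_walk_aut (aut_inv g)) /=.
rewrite avertK -map_comp; congr (is_walk x _).
by rewrite -[RHS]map_id; apply: eq_map => e /=; rewrite aedgeK.
Qed.

Lemma walk_weight_rev x s : is_walk x s -> walk_weight (walk_end x s) (walk_rev s) = walk_weight x s.
Proof.
by move=> ws; rewrite (walk_weight_walk ws) (weight_reversible w_good) -walk_weight_gpath.
Qed.

Lemma walk_weight_nil x : walk_weight x [::] = 1.
Proof. by rewrite (@walk_weight_walk x [::] isT) (weight_length0 w_good). Qed.

Lemma walk_weight_edge_ge1 x e : src e = x -> 1 <= walk_weight x [:: e].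
Proof.
move=> ex; have we : is_walk x [:: e] by rewrite /= ex eqxx.
by rewrite (walk_weight_walk we) (weight_length1 w_good).
Qed.

Lemma walk_weight_cat_le x s1 s2 : is_walk x (s1 ++ s2) ->
  walk_weight x (s1 ++ s2) <= walk_weight x s1 * walk_weight (walk_end x s1) s2.
Proof.
rewrite is_walk_cat => /andP[w1 w2]; rewrite (walk_weight_walk w1) (@walk_weight_walk (walk_end x s1) s2 w2).
have c : contiguous (@GPath G (x, s1) w1) (@GPath G (walk_end x s1, s2) w2) by [].
by have := weight_repulsive w_good c; rewrite -(walk_weight_gpath (path_cat c)).
Qed.

Lemma pvert_walk x s (ws : is_walk x s) i : (i <= size s)%N ->
  pvert (@GPath G (x, s) ws) i = walk_end x (take i s).
Proof.
rewrite /pvert /pstart /pedges /= => {ws}; elim: s x i => [|e s IH] x [|i] //= si.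
rewrite (set_nth_default (tgt e)) /= ?size_map//.
exact: IH.
Qed.

(** Two walks at disjoint sets of heights visit disjoint sets of vertices, so
heights are enough to invoke the zero-range property. *)
Lemma walk_weight_cat_eq x s1 s2 : is_walk x (s1 ++ s2) ->
  (forall i j, (i < size s1)%N -> (0 < j <= size s2)%N ->
     height (take i s1) != height s1 + height (take j s2)) ->
  walk_weight x (s1 ++ s2) = walk_weight x s1 * walk_weight (walk_end x s1) s2.
Proof.
move=> w12 dis; have := w12; rewrite is_walk_cat => /andP[w1 w2].
rewrite (walk_weight_walk w1) (@walk_weight_walk (walk_end x s1) s2 w2).
have c : contiguous (@GPath G (x, s1) w1) (@GPath G (walk_end x s1, s2) w2) by [].
rewrite -(weight_zero_range w_good (c : contiguous _ _)) -?(walk_weight_gpath (path_cat c))//.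
move=> i j si sj; rewrite (pvert_walk w1) ?(ltnW si)// pvert_walk; last by case/andP: sj.
rewrite -walk_end_cat => eqv; have := dis i j si sj.
rewrite -height_cat => /eqP; apply.
apply: (@walk_height_eq x) eqv.
  by have := w1; rewrite -{1}(cat_take_drop i s1) is_walk_cat => /andP[].
by have := w12; rewrite -{1}(cat_take_drop j s2) catA is_walk_cat => /andP[].
Qed.

Definition tilted_weight (lam : R) x s : R := walk_weight x s * expR (lam * height s).

Lemma tilted_weight_ge0 lam x s : 0 <= tilted_weight lam x s.
Proof. by rewrite mulr_ge0 ?walk_weight_ge0 ?expR_ge0. Qed.

Lemma tilted_weight_act lam g x s : g \in Gam ->
  tilted_weight lam (avert g x) (map (aedge g) s) = tilted_weight lam x s.
Proof. by move=> gG; rewrite /tilted_weight walk_weight_act// height_act. Qed.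

Lemma tilted_weight_nil lam x : tilted_weight lam x [::] = 1.
Proof. by rewrite /tilted_weight walk_weight_nil height_nil mulr0 expR0 mulr1. Qed.

Lemma tilted_weight_cat_le lam x s1 s2 : is_walk x (s1 ++ s2) ->
  tilted_weight lam x (s1 ++ s2) <= tilted_weight lam x s1 * tilted_weight lam (walk_end x s1) s2.
Proof.
move=> w12; rewrite /tilted_weight height_cat mulrDr expRD mulrACA.
by rewrite ler_wpM2r ?walk_weight_cat_le.
Qed.

Lemma tilted_weight_cat_eq lam x s1 s2 : is_walk x (s1 ++ s2) ->
  (forall i j, (i < size s1)%N -> (0 < j <= size s2)%N ->
     height (take i s1) != height s1 + height (take j s2)) ->
  tilted_weight lam x (s1 ++ s2) = tilted_weight lam x s1 * tilted_weight lam (walk_end x s1) s2.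
Proof.
by move=> w12 dis; rewrite /tilted_weight height_cat mulrDr expRD mulrACA walk_weight_cat_eq.
Qed.

Definition tilted_sum (lam : R) (P : pred (seq (edge G))) n : R :=
  \sum_(s <- walks o n | P s) tilted_weight lam o s.

Definition Gam_invariant (P : pred (seq (edge G))) :=
  forall g s, g \in Gam -> P (map (aedge g) s) = P s.

Lemma Zsum_tilted_sum lam n : Zsum Gam o w lam n = tilted_sum lam xpredT n.
Proof.
pose L : seq (gpath G) := pmap insub (map (pair o) (walks o n)).
have LE : map val L = map (pair o) (walks o n).
  rewrite /L (pmap_filter (insubK _)); apply/all_filterP/allP => _ /mapP[s sW ->].
  by move: sW; rewrite (mem_walks G_locfin) isSome_insub /= => /andP[].
have Lu : uniq L.
  rewrite -(map_inj_uniq val_inj) LE map_inj_uniq ?walks_uniq//.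
  by move=> s1 s2 [].
have LP om : om \in L -> pstart om = o /\ plen om = n.
  move=> omL; have := map_f val omL; rewrite LE => /mapP[s].
  rewrite (mem_walks G_locfin) => /andP[_ /eqP <-] oms.
  by split; rewrite /plen /pstart /pedges [pdata om]oms.
rewrite /Zsum (_ : paths_from o n = [set` L]); last first.
  apply/seteqP; split=> om /=; last exact: LP.
  move=> [omo omn]; rewrite -(mem_map val_inj) LE; apply/mapP.
  exists (pedges om); last by rewrite -omo /= [LHS]surjective_pairing.
  rewrite (mem_walks G_locfin) -{1}omo; apply/andP; split; last exact/eqP.
  exact: (pdataP om).
rewrite -fsbig_seq// /tilted_sum.
transitivity (\sum_(p <- map val L) (tilted_weight lam p.1 p.2)); last by rewrite LE big_map.
rewrite big_map; apply: eq_big_seq => om omL; rewrite -walk_weight_gpath /tilted_weight /powR.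
rewrite gt_eqF; last exact: modular_gt0.
have [omo _] := LP _ omL.
have <- : expR (height (pedges om)) = D o (pend om).
  by rewrite (@expR_height o) /pend ?omo// -omo; exact: (pdataP om).
by rewrite expRK.
Qed.

(** By transitivity the starting vertex is immaterial; this is what makes sums
over concatenated walks factorize. *)
Lemma sum_tilted_weight_base lam P x n : Gam_invariant P ->
  \sum_(s <- walks x n | P s) tilted_weight lam x s = tilted_sum lam P n.
Proof.
move=> Pinv; have [g gG <-] := Gam_transitive o x.
rewrite big_mkcond (sum_walks_act G_locfin) /tilted_sum [RHS]big_mkcond.
by apply: eq_bigr => s _; rewrite Pinv// tilted_weight_act.
Qed.

Lemma tilted_sum_ge0 lam P n : 0 <= tilted_sum lam P n.
Proof. by apply: sumr_ge0 => s _; exact: tilted_weight_ge0. Qed.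

Lemma tilted_sum0 lam (P : pred (seq (edge G))) : P [::] -> tilted_sum lam P 0 = 1.
Proof. by move=> P0; rewrite /tilted_sum big_mkcond sum_walks0 P0 tilted_weight_nil. Qed.

Lemma split_tilted_sum lam (P1 : pred (seq (edge G)))
    (P2 : seq (edge G) -> pred (seq (edge G))) k l :
  \sum_(s <- walks o (k + l) | P1 (take k s) && P2 (take k s) (drop k s)) tilted_weight lam o s =
  \sum_(s1 <- walks o k | P1 s1)
    \sum_(s2 <- walks (walk_end o s1) l | P2 s1 s2) tilted_weight lam o (s1 ++ s2).
Proof.
rewrite big_mkcond sum_walks_cat [RHS]big_mkcond; apply: eq_big_seq => s1.
rewrite (mem_walks G_locfin) => /andP[_ /eqP s1k].
under eq_bigr do rewrite take_cat drop_cat s1k ltnn subnn take0 drop0 cats0.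
case: (P1 s1) => /=; last by rewrite big1.
by rewrite -big_mkcond.
Qed.

Lemma walk_catP k l s1 s2 : s1 \in walks o k -> s2 \in walks (walk_end o s1) l ->
  is_walk o (s1 ++ s2).
Proof. by rewrite !(mem_walks G_locfin) is_walk_cat => /andP[-> _] /andP[-> _]. Qed.

(** Cutting walks after k steps. The class allowed for the second piece may depend
on the first one, as needed when the height of a bridge limits what follows. *)
Lemma tilted_sum_split_le lam (P1 : pred (seq (edge G)))
    (P2 : seq (edge G) -> pred (seq (edge G))) k l :
  (forall s1, Gam_invariant (P2 s1)) ->
  \sum_(s <- walks o (k + l) | P1 (take k s) && P2 (take k s) (drop k s)) tilted_weight lam o s <=
  \sum_(s1 <- walks o k | P1 s1) tilted_weight lam o s1 * tilted_sum lam (P2 s1) l.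
Proof.
move=> Pinv; rewrite split_tilted_sum big_seq_cond [leRHS]big_seq_cond.
apply: ler_sum => s1 /andP[s1W _]; rewrite -(sum_tilted_weight_base lam (walk_end o s1) l (Pinv s1)).
rewrite mulr_sumr big_seq_cond [leRHS]big_seq_cond; apply: ler_sum => s2 /andP[s2W _].
by apply: tilted_weight_cat_le; exact: walk_catP s1W s2W.
Qed.

Lemma tilted_sum_split_eq lam (P1 : pred (seq (edge G)))
    (P2 : seq (edge G) -> pred (seq (edge G))) k l :
  (forall s1, Gam_invariant (P2 s1)) ->
  (forall s1 s2 i j, P1 s1 -> P2 s1 s2 -> (i < size s1)%N -> (0 < j <= size s2)%N ->
     height (take i s1) != height s1 + height (take j s2)) ->
  \sum_(s <- walks o (k + l) | P1 (take k s) && P2 (take k s) (drop k s)) tilted_weight lam o s =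
  \sum_(s1 <- walks o k | P1 s1) tilted_weight lam o s1 * tilted_sum lam (P2 s1) l.
Proof.
move=> Pinv dis; rewrite split_tilted_sum big_seq_cond [RHS]big_seq_cond.
apply: eq_bigr => s1 /andP[s1W Ps1]; rewrite -(sum_tilted_weight_base lam (walk_end o s1) l (Pinv s1)).
rewrite mulr_sumr big_seq_cond [RHS]big_seq_cond; apply: eq_bigr => s2 /andP[s2W Ps2].
by apply: tilted_weight_cat_eq; [exact: walk_catP s1W s2W|move=> i j; exact: dis].
Qed.

Lemma tilted_sumM_le lam k l :
  tilted_sum lam xpredT (k + l) <= tilted_sum lam xpredT k * tilted_sum lam xpredT l.
Proof.
have := @tilted_sum_split_le lam xpredT (fun=> xpredT) k l (fun _ _ _ _ => erefl).
by rewrite -mulr_suml.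
Qed.

(** Reversal negates the height, and mass transport costs a factor exp(h). *)
Lemma tilted_sum_symm lam n : tilted_sum (1 - lam) xpredT n = tilted_sum lam xpredT n.
Proof.
rewrite /tilted_sum [RHS](mass_transport G_connected G_locfin Gam_subgroup Gam_transitive); last first.
  by move=> g gG x s; exact: tilted_weight_act.
rewrite !big_seq; apply: eq_bigr => s; rewrite (mem_walks G_locfin) => /andP[ws _].
rewrite -(expR_height ws) /tilted_weight walk_weight_rev// height_walk_rev -mulrA -expRD.
by congr (_ * expR _); ring.
Qed.

End Heights.

(** * Bridges and half-space walks *)

Section Bridges.
Variables (R : realType) (G : mgraph).
Hypotheses (G_connected : connected_graph G) (G_locfin : locally_finite G).
Variable Gam : {pred aut G}.
Hypotheses (Gam_subgroup : group_closed Gam) (Gam_transitive : transitive_aut Gam).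
Variables (o : vert G) (w : gpath G -> R).
Hypothesis w_good : good_weight Gam w.
Hypothesis Gam_nonunimodular : ~ unimodular R Gam.
Implicit Types (s r t : seq (edge G)) (c S : R).

Local Notation height := (@height R G Gam).
Local Notation tilt := (tilted_weight Gam w).
Local Notation walk_sum := (tilted_sum Gam o w).

(** The parameter c is a nonzero real rather than a sign: its sign chooses between
ascending and descending bridges, while c itself will be a shift of the tilt, under
which the weight of a walk is multiplied by exp(c h). *)
Definition bridge c s : bool :=
  `[< forall i, (0 < i <= size s)%N -> 0 < c * height (take i s) <= c * height s >].

Definition irreducible_bridge c s : bool :=
  [&& s != [::], bridge c s &
    `[< forall k, (0 < k < size s)%N -> ~~ (bridge c (take k s) && bridge c (drop k s)) >]].

(** The bound S lets the decomposition into bridges record that their spans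
decrease. *)
Definition half_space c S s : bool :=
  `[< forall i, (0 < i <= size s)%N -> 0 < c * height (take i s) < S >].

Definition weak_half_space c s : bool :=
  `[< forall i, (i <= size s)%N -> 0 <= c * height (take i s) >].

Definition ends_at_bottom c s : bool :=
  `[< forall i, (i <= size s)%N -> c * height s <= c * height (take i s) >].

Lemma height_take_drop k j s :
  height (take j (drop k s)) = height (take (k + j) s) - height (take k s).
Proof. by rewrite takeD height_cat addrC addKr. Qed.

Lemma height_drop k s : height (drop k s) = height s - height (take k s).
Proof. by rewrite -{2}(cat_take_drop k s) height_cat addrC addKr. Qed.

Lemma take_act (g : aut G) i s : take i (map (aedge g) s) = map (aedge g) (take i s).
Proof. by rewrite map_take. Qed.

Lemma bridge_inv c : Gam_invariant Gam (bridge c).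
Proof.
move=> g s gG; rewrite /bridge size_map height_act//; apply: asbool_equiv_eq.
by split=> + i => /(_ i); rewrite take_act height_act.
Qed.

Lemma half_space_inv c S : Gam_invariant Gam (half_space c S).
Proof.
move=> g s gG; rewrite /half_space size_map; apply: asbool_equiv_eq.
by split=> + i => /(_ i); rewrite take_act height_act.
Qed.

Lemma weak_half_space_inv c : Gam_invariant Gam (weak_half_space c).
Proof.
move=> g s gG; rewrite /weak_half_space size_map; apply: asbool_equiv_eq.
by split=> + i => /(_ i); rewrite take_act height_act.
Qed.

Lemma ends_at_bottom_inv c : Gam_invariant Gam (ends_at_bottom c).
Proof.
move=> g s gG; rewrite /ends_at_bottom size_map height_act//; apply: asbool_equiv_eq.
by split=> + i => /(_ i); rewrite take_act height_act.
Qed.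

Lemma bridge_nil c : bridge c [::].
Proof. by apply/asboolP => -[|i]. Qed.

Lemma bridge_ge0 c s : bridge c s -> 0 <= c * height s.
Proof.
case: s => [_|e s /asboolP bs]; first by rewrite height_nil mulr0.
by have /andP[/ltW le0 _] := bs (size (e :: s)) (leqnn _); rewrite take_size in le0.
Qed.

Lemma bridge_cat c r t : bridge c r -> bridge c t -> bridge c (r ++ t).
Proof.
move=> br bt; have t0 := bridge_ge0 bt; move: br bt => /asboolP br /asboolP bt.
apply/asboolP => i; rewrite size_cat take_cat height_cat mulrDr => /andP[i0 ile].
case: ltnP => ir.
  have /andP[-> le] := br i (ltac:(lia)).
  by rewrite /= (le_trans le)// lerDl.
rewrite height_cat mulrDr lerD2l.
have r0 : 0 <= c * height r by apply: bridge_ge0; exact/asboolP.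
have [ri|ri] := eqVneq i (size r).
  have /andP[gt _] := br i (ltac:(lia)).
  by move: gt; rewrite ri take_size subnn take0 height_nil mulr0 addr0 => ->.
have /andP[gt ->] := bt (i - size r)%N (ltac:(lia)).
by rewrite andbT (lt_le_trans gt)// lerDr.
Qed.

(** A tail of a bridge automatically stays below its end. That it stays above its
start can be checked on any extension of it. *)
Lemma bridge_drop_prefix c r t j : (j <= size r)%N -> bridge c r ->
  bridge c (drop j r ++ t) -> bridge c (drop j r).
Proof.
move=> jr /asboolP br /asboolP bt; apply/asboolP => i /andP[i0 ir].
rewrite size_drop in ir.
have := bt i; rewrite i0 size_cat size_drop take_cat size_drop.
move=> /(_ ltac:(lia)) /andP[gt _]; apply/andP; split.
  move: gt; case: ltnP => // ri; have -> : (i = size r - j)%N by lia.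
  by rewrite subnn take0 cats0 -size_drop take_size.
rewrite height_take_drop height_drop !mulrBr lerD2r.
have /andP[_] := br (j + i)%N (ltac:(lia)).
by [].
Qed.

(** Cut at the first possible place: an earlier cut of the first piece would be an
earlier cut of the whole bridge. *)
Lemma bridge_first_cut c s : s != [::] -> bridge c s ->
  exists k, [/\ (k < size s)%N, irreducible_bridge c (take k.+1 s) &
             bridge c (drop k.+1 s)].
Proof.
move=> s0 bs.
pose P k := [&& (k < size s)%N, bridge c (take k.+1 s) & bridge c (drop k.+1 s)].
have exP : exists k, P k.
  have sz : (0 < size s)%N by rewrite lt0n size_eq0.
  exists (size s).-1; rewrite /P prednK// leqnn take_size bs drop_size.
  exact: bridge_nil.
case: (ex_minnP exP) => k /and3P[ks bt bd] kmin; exists k; split => //.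
apply/and3P; split => //; first by rewrite -size_eq0 size_takel.
apply/asboolP => j; rewrite size_takel// => /andP[j0 jk].
apply/negP => /andP[b1 b2].
have /kmin : P j.-1.
  rewrite /P prednK//; apply/and3P; split; first by lia.
    by move: b1; rewrite take_takel// ltnW.
  have -> : drop j s = drop j (take k.+1 s) ++ drop k.+1 s.
    by rewrite -{1}(cat_take_drop k.+1 s) drop_cat size_takel// jk.
  exact: bridge_cat.
by lia.
Qed.

(** Conversely, an irreducible first piece leaves no room for an earlier cut, which
makes the decomposition unique. *)
Lemma irreducible_cut_minimal c s j k :
  (j < k < size s)%N -> bridge c (take j.+1 s) -> bridge c (drop j.+1 s) ->
  ~~ irreducible_bridge c (take k.+1 s).
Proof.
move=> /andP[jk ks] b1 b2; apply/negP => /and3P[_ bk /asboolP irr].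
have szk : size (take k.+1 s) = k.+1 by rewrite size_takel.
have /negP := irr j.+1 (ltac:(lia)); apply; apply/andP; split.
  by rewrite take_takel// ltnW.
apply: (@bridge_drop_prefix c _ (drop k.+1 s)) => //; first by lia.
have -> : drop j.+1 (take k.+1 s) ++ drop k.+1 s = drop j.+1 s.
  by rewrite -[in RHS](cat_take_drop k.+1 s) drop_cat szk ltnS jk.
exact: b2.
Qed.

Lemma bridge_cut_sum c s n : size s = n.+1 ->
  (bridge c s)%:R = \sum_(k < n.+1)
    (irreducible_bridge c (take k.+1 s) && bridge c (drop k.+1 s))%:R :> R.
Proof.
move=> sn; have s0 : s != [::] by rewrite -size_eq0 sn.
case/boolP: (bridge c s) => bs.
  have [k [ks ik bk]] := bridge_first_cut s0 bs.
  rewrite sn in ks; rewrite (bigD1 (Ordinal ks))//= ik bk big1 ?addr0// => j jk.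
  have {}jk : nat_of_ord j != k by apply: contraNneq jk => jk; apply/eqP/val_inj.
  apply/eqP; rewrite pnatr_eq0 eqb0; apply/negP => /andP[ij bj].
  have [lt|gt|eq] := ltngtP j k; last by rewrite eq eqxx in jk.
    move: ij => /and3P[_ bj' _].
    by have := @irreducible_cut_minimal c s j k; rewrite lt sn ks bj' bj ik => /(_ isT isT isT).
  move: ik => /and3P[_ bk' _].
  have := @irreducible_cut_minimal c s k j; rewrite gt sn ltn_ord bk' bk ij.
  by move=> /(_ isT isT isT).
rewrite big1// => k _; apply/eqP; rewrite pnatr_eq0 eqb0; apply: contra bs.
move=> /andP[/and3P[_ b1 _] b2]; rewrite -(cat_take_drop k.+1 s).
exact: bridge_cat.
Qed.

(** The weights multiply because the pieces of a bridge occupy disjoint ranges of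
heights. *)
Lemma bridge_renewal lam c n :
  walk_sum lam (bridge c) n.+1 =
  \sum_(k < n.+1) walk_sum lam (irreducible_bridge c) k.+1 *
                  walk_sum lam (bridge c) (n - k).
Proof.
transitivity (\sum_(k < n.+1) \sum_(s <- walks o (k.+1 + (n - k)) |
    irreducible_bridge c (take k.+1 s) && bridge c (drop k.+1 s)) tilt lam o s).
  transitivity (\sum_(k < n.+1) \sum_(s <- walks o n.+1)
    (irreducible_bridge c (take k.+1 s) && bridge c (drop k.+1 s))%:R * tilt lam o s).
    rewrite exchange_big /= /tilted_sum big_mkcond; apply: eq_big_seq => s.
    rewrite (mem_walks G_locfin) => /andP[_ /eqP sn].
    rewrite -mulr_suml -bridge_cut_sum//; case: bridge; first by rewrite mul1r.
    by rewrite mul0r.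
  apply: eq_bigr => k _; rewrite [RHS]big_mkcond.
  have -> : (k.+1 + (n - k) = n.+1)%N by have := ltn_ord k; lia.
  by apply: eq_bigr => s _; case: andb; rewrite ?mul1r ?mul0r.
apply: eq_bigr => k _.
rewrite (@tilted_sum_split_eq _ _ G_connected G_locfin _ Gam_subgroup Gam_transitive
  _ _ w_good _ _ (fun=> bridge c)) ?mulr_suml//.
  by move=> _; exact: bridge_inv.
move=> s1 s2 i j /and3P[_ b1 _] /asboolP b2 i1 /b2 /andP[j2 _].
apply/eqP => /(congr1 (fun u => c * u)); rewrite mulrDr => eq.
suff : c * height (take i s1) <= c * height s1 by rewrite eq; lra.
case: i i1 {eq} => [|i] i1; first by rewrite take0 height_nil mulr0 bridge_ge0.
by move/asboolP: b1 => /(_ i.+1 (ltnW i1)) /andP[].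
Qed.

Lemma last_argmax (f : nat -> R) n : exists k, [/\ (k <= n)%N,
  forall i, (i <= n)%N -> f i <= f k & forall i, (k < i <= n)%N -> f i < f k].
Proof.
elim: n => [|n [k [kn kmax klast]]].
  by exists 0%N; split => // -[|i].
have [le|gt] := leP (f k) (f n.+1).
  exists n.+1; split => // i; last by lia.
  by rewrite leq_eqVlt => /predU1P[->//|/kmax/le_trans]; exact.
exists k; split; first exact: leqW.
  by move=> i; rewrite leq_eqVlt => /predU1P[->|/kmax//]; exact: ltW.
move=> i /andP[ki]; rewrite leq_eqVlt => /predU1P[->//|iN].
by apply: klast; rewrite ki.
Qed.

(** Cut at the last highest point. The rest of the walk descends strictly from
there without returning to the starting height, so that it is a half-space walk
for the opposite sign whose span is smaller than that of the first bridge. *)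
Lemma half_space_first_bridge c S s : s != [::] -> half_space c S s ->
  exists k, [/\ (k < size s)%N, bridge c (take k.+1 s),
    c * height (take k.+1 s) < S &
    half_space (- c) (c * height (take k.+1 s)) (drop k.+1 s)].
Proof.
move=> s0 /asboolP hs; have sz : (0 < size s)%N by rewrite lt0n size_eq0.
have [k [kn kmax klast]] := last_argmax (fun i => c * height (take i s)) (size s).
case: k kn kmax klast => [|k] ks kmax klast.
  have := klast 1%N; rewrite sz take0 height_nil mulr0 => /(_ isT).
  by have /andP[/lt_trans gt _] := hs 1%N sz => /gt; rewrite ltxx.
exists k; split => //.
- apply/asboolP => i; rewrite size_takel// => /andP[i0 ik]; rewrite take_takel//.
  rewrite kmax ?andbT; last by lia.
  by have /andP[] := hs i (ltac:(lia)).
- by have /andP[] := hs k.+1 ks.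
apply/asboolP => i; rewrite size_drop => /andP[i0 ik].
rewrite height_take_drop mulNr mulrBr.
have /andP[gt _] := hs (k.+1 + i)%N (ltac:(lia)).
have := klast (k.+1 + i)%N (ltac:(lia)).
lra.
Qed.

Lemma half_space_sum_le lam c S n :
  walk_sum lam (half_space c S) n.+1 <=
  \sum_(k < n.+1) \sum_(s <- walks o k.+1 | bridge c s && (c * height s < S))
    tilt lam o s * walk_sum lam (half_space (- c) (c * height s)) (n - k).
Proof.
pose P1 s := bridge c s && (c * height s < S).
pose P2 s := half_space (- c) (c * height s).
apply: (@le_trans _ _ (\sum_(k < n.+1) \sum_(s <- walks o (k.+1 + (n - k)) |
    P1 (take k.+1 s) && P2 (take k.+1 s) (drop k.+1 s)) tilt lam o s)).
  apply: (@le_trans _ _ (\sum_(k < n.+1) \sum_(s <- walks o n.+1)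
    (P1 (take k.+1 s) && P2 (take k.+1 s) (drop k.+1 s))%:R * tilt lam o s)).
    rewrite exchange_big /= /tilted_sum big_mkcond big_seq [leRHS]big_seq.
    apply: ler_sum => s; rewrite (mem_walks G_locfin) => /andP[_ /eqP sn].
    rewrite -mulr_suml; have T0 := tilted_weight_ge0 w_good lam o s.
    case: ifPn => hs; last by rewrite mulr_ge0// sumr_ge0.
    have s0 : s != [::] by rewrite -size_eq0 sn.
    have [k [ks b1 b2 b3]] := half_space_first_bridge s0 hs.
    rewrite sn in ks; rewrite ler_peMl// (bigD1 (Ordinal ks))//= /P1 /P2 b1 b2 b3.
    by rewrite lerDl sumr_ge0.
  apply: ler_sum => k _; rewrite [leRHS]big_mkcond.
  have -> : (k.+1 + (n - k) = n.+1)%N by have := ltn_ord k; lia.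
  by apply: ler_sum => s _; case: andb; rewrite ?mul1r ?mul0r.
apply: ler_sum => k _; apply: (tilted_sum_split_le G_connected G_locfin Gam_subgroup
  Gam_transitive _ w_good _ P1 (P2 := P2)) => //.
by move=> s; exact: half_space_inv.
Qed.

(** Cut at the last lowest point. *)
Lemma walk_bottom_split c M s x : c != 0 -> 0 <= M ->
  (forall x s, is_walk x s -> `|height s| <= M * (size s)%:R) -> is_walk x s ->
  exists k, [/\ (k <= size s)%N, ends_at_bottom c (take k s) &
    half_space c (`|c| * (M * (size s)%:R) + 1) (drop k s)].
Proof.
move=> c0 M0 hM ws.
have [k [kn kmax klast]] := last_argmax (fun i => - c * height (take i s)) (size s).
exists k; split => //.
  apply/asboolP => i; rewrite size_takel// => ik; rewrite take_takel//.
  by rewrite -lerN2 -!mulNr kmax//; lia.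
apply/asboolP => i; rewrite size_drop => /andP[i0 ik]; apply/andP; split.
  rewrite height_take_drop mulrBr.
  have := klast (k + i)%N (ltac:(lia)); lra.
have wd : is_walk (walk_end x (take k s)) (take i (drop k s)).
  move: ws; rewrite -{1}(cat_take_drop k s) is_walk_cat => /andP[_].
  by rewrite -{1}(cat_take_drop i (drop k s)) is_walk_cat => /andP[].
apply: (@le_lt_trans _ _ (`|c| * (M * (size s)%:R))); last by lra.
apply: le_trans (ler_norm _) _; rewrite normrM ler_wpM2l//.
apply: (le_trans (hM _ _ wd)); rewrite ler_wpM2l// ler_nat size_takel ?size_drop//.
by lia.
Qed.

Lemma ends_at_bottom_rev c s : ends_at_bottom c (walk_rev s) = weak_half_space c s.
Proof.
have E i : (i <= size s)%N ->
    height (take i (walk_rev s)) = height (take (size s - i) s) - height s.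
  move=> si; rewrite -{1}(cat_take_drop (size s - i) s) walk_rev_cat.
  rewrite take_cat size_walk_rev size_drop subKn// ltnn subnn take0 cats0.
  by rewrite height_walk_rev// height_drop opprB.
apply: asbool_equiv_eq; rewrite size_walk_rev; split=> H i si.
  have := H (size s - i)%N (leq_subr _ _).
  by rewrite E ?leq_subr// subKn// height_walk_rev// mulrBr mulrN lerBrDr addNr.
rewrite E// height_walk_rev// mulrBr mulrN lerBrDr addNr.
by apply: H; exact: leq_subr.
Qed.

(** At the tilt 1/2 mass transport preserves the tilted weight exactly, so walks may
be reversed freely. *)
Lemma ends_at_bottom_sum c n :
  walk_sum 2^-1 (ends_at_bottom c) n = walk_sum 2^-1 (weak_half_space c) n.
Proof.
pose f x s := (ends_at_bottom c s)%:R * tilt 2^-1 x s.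
transitivity (\sum_(s <- walks o n) f o s).
  rewrite /tilted_sum big_mkcond; apply: eq_bigr => s _; rewrite /f.
  by case: ifP; rewrite ?mul1r ?mul0r.
rewrite (mass_transport G_connected G_locfin Gam_subgroup Gam_transitive); last first.
  by move=> g gG x s; rewrite /f ends_at_bottom_inv// tilted_weight_act.
rewrite /tilted_sum [RHS]big_mkcond; apply: eq_big_seq => s.
rewrite (mem_walks G_locfin) => /andP[ws _]; rewrite /f ends_at_bottom_rev.
case: ifP => _; last by rewrite !mul0r.
rewrite mul1r -(expR_height R G_connected G_locfin Gam_subgroup ws).
rewrite /tilted_weight (walk_weight_rev w_good)// height_walk_rev// -mulrA -expRD.
by congr (_ * expR _); field.
Qed.

(** Prepending one ascending edge turns a weak half-space walk into a strict one. The
zero-range property applies, since the new vertex lies below all the others. *)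
Lemma weak_half_space_sum_le c : c != 0 -> exists2 C : R, 0 < C &
  forall M n, 0 <= M ->
  (forall x s, is_walk x s -> `|height s| <= M * (size s)%:R) ->
  walk_sum 2^-1 (weak_half_space c) n <=
  C * walk_sum 2^-1 (half_space c (`|c| * (M * (n.+1)%:R) + 1)) n.+1.
Proof.
move=> c0; have [e eo he] := exists_sloped_edge G_connected G_locfin Gam_subgroup
  Gam_transitive o Gam_nonunimodular c0.
have Te : 0 < tilt 2^-1 o [:: e].
  rewrite mulr_gt0 ?expR_gt0// (lt_le_trans ltr01)//; exact: (walk_weight_edge_ge1 w_good).
exists (tilt 2^-1 o [:: e])^-1; first by rewrite invr_gt0.
move=> M n M0 hM; rewrite ler_pdivlMl//.
rewrite -(sum_tilted_weight_base G_connected G_locfin Gam_subgroup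
  Gam_transitive o w_good _ (tgt e)); last exact: weak_half_space_inv.
rewrite /tilted_sum [leRHS]big_mkcond sum_walksS.
rewrite (big_rem e) ?mem_out_edges ?eo//=.
apply: (@le_trans _ _ (\sum_(s <- walks (tgt e) n)
  (if half_space c (`|c| * (M * n.+1%:R) + 1) (e :: s)
   then tilt 2^-1 o (e :: s) else 0))); last first.
  rewrite lerDl sumr_ge0// => e' _; rewrite sumr_ge0// => s _.
  by case: ifP => // _; exact: tilted_weight_ge0.
rewrite mulr_sumr big_mkcond big_seq [leRHS]big_seq; apply: ler_sum => s.
rewrite (mem_walks G_locfin) => /andP[ws /eqP sn].
have wes : is_walk o (e :: s) by rewrite /= eo eqxx.
case: ifPn => [/asboolP whs|_]; last by case: ifP => // _; exact: tilted_weight_ge0.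
have pos i : (i <= size s)%N -> 0 < c * (edge_height R Gam e + height (take i s)).
  by move=> /whs; rewrite mulrDr; lra.
rewrite ifT; last first.
  apply/asboolP => -[|i]//= si; rewrite height_cons pos//=.
  apply: (@le_lt_trans _ _ (`|c| * (M * (n.+1)%:R))); last by lra.
  rewrite -height_cons.
  have wei : is_walk o (e :: take i s).
    by rewrite /= eo eqxx; move: ws; rewrite -{1}(cat_take_drop i s) is_walk_cat => /andP[].
  apply: le_trans (ler_norm _) _; rewrite normrM ler_wpM2l//.
  apply: (le_trans (hM _ _ wei)); rewrite ler_wpM2l// ler_nat /= size_takel//.
  by rewrite -sn.
rewrite (@tilted_weight_cat_eq _ _ G_connected G_locfin _ Gam_subgroup _ w_good _ _ [:: e] s)//.
move=> [|i] j //= _ /andP[_ js]; rewrite height_nil height1.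
by apply/eqP => e0; have := pos j js; rewrite -e0 mulr0 ltxx.
Qed.

Lemma tilted_sum_le_half_space c M n : c != 0 -> 0 <= M ->
  (forall x s, is_walk x s -> `|height s| <= M * (size s)%:R) ->
  walk_sum 2^-1 xpredT n <=
  \sum_(k < n.+1) walk_sum 2^-1 (weak_half_space c) k *
    walk_sum 2^-1 (half_space c (`|c| * (M * n%:R) + 1)) (n - k).
Proof.
move=> c0 M0 hM; set S := (_ + 1).
apply: (@le_trans _ _ (\sum_(k < n.+1) \sum_(s <- walks o (k + (n - k)) |
    ends_at_bottom c (take k s) && half_space c S (drop k s)) tilt 2^-1 o s)).
  apply: (@le_trans _ _ (\sum_(k < n.+1) \sum_(s <- walks o n)
    (ends_at_bottom c (take k s) && half_space c S (drop k s))%:R * tilt 2^-1 o s)).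
    rewrite exchange_big /= /tilted_sum big_seq [leRHS]big_seq.
    apply: ler_sum => s; rewrite (mem_walks G_locfin) => /andP[ws /eqP sn].
    rewrite -mulr_suml; have T0 := tilted_weight_ge0 w_good 2^-1 o s.
    have [k [ks b1 b2]] := walk_bottom_split c0 M0 hM ws.
    rewrite sn -ltnS in ks; rewrite sn -/S in b2.
    rewrite ler_peMl// (bigD1 (Ordinal ks))//= b1 b2.
    by rewrite lerDl sumr_ge0.
  apply: ler_sum => k _; rewrite [leRHS]big_mkcond.
  have -> : (k + (n - k) = n)%N by have := ltn_ord k; lia.
  by apply: ler_sum => s _; case: andb; rewrite ?mul1r ?mul0r.
apply: ler_sum => k _; rewrite -ends_at_bottom_sum mulr_suml.
apply: (tilted_sum_split_le G_connected G_locfin Gam_subgroup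
  Gam_transitive _ w_good _ _ (P2 := fun=> half_space c S)).
by move=> s; exact: half_space_inv.
Qed.

End Bridges.

(** * Growth rates of submultiplicative sequences *)

Section GrowthRate.
Variable R : realType.
Implicit Types (Z : nat -> R) (m : R).

(** For a submultiplicative sequence, the two-sided control given by the equality
of the limit and the infimum of its n-th roots. *)
Definition growth_rate Z m :=
  [/\ 0 < m, forall n, m ^+ n <= Z n &
      forall r, m < r -> exists2 C, 0 < C & forall n, Z n <= C * r ^+ n].

Lemma expr_le_const (a b C : R) : 0 < b ->
  (forall n, a ^+ n <= C * b ^+ n) -> a <= b.
Proof.
move=> b0 le; rewrite leNgt; apply/negP => ba.
have a0 : 0 < a by exact: lt_trans ba.
have C0 : 0 < C by have := le 0%N; rewrite !expr0 mulr1; exact: lt_le_trans.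
have q1 : `|b / a| < 1 by rewrite gtr0_norm ?divr_gt0// ltr_pdivrMr ?mul1r.
have /cvgrPdist_lt/(_ C^-1) := cvg_expr q1.
rewrite invr_gt0 => /(_ C0)[n _ /(_ n (leqnn n))] /=.
rewrite sub0r normrN gtr0_norm; last by rewrite exprn_gt0// divr_gt0.
rewrite expr_div_n ltr_pdivrMr ?exprn_gt0// mulrC ltr_pdivlMr// mulrC.
by move/(le_lt_trans (le n)); rewrite ltxx.
Qed.

Lemma submultiplicative_expn Z k q : (forall n, 0 <= Z n) ->
  (forall k l, Z (k + l)%N <= Z k * Z l) -> Z 0%N = 1 ->
  Z (q * k)%N <= Z k ^+ q.
Proof.
move=> Z0 ZM Z1; elim: q => [|q IH]; first by rewrite mul0n expr0 Z1.
rewrite mulSn exprS; apply: (le_trans (ZM _ _)).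
by apply: ler_wpM2l.
Qed.

Lemma submultiplicative_upper Z k r : (forall n, 0 <= Z n) ->
  (forall k l, Z (k + l)%N <= Z k * Z l) -> Z 0%N = 1 ->
  0 < r -> (0 < k)%N -> Z k <= r ^+ k ->
  exists2 C, 0 < C & forall n, Z n <= C * r ^+ n.
Proof.
move=> Z0 ZM Z1 r0 k0 Zk; exists (1 + \sum_(i < k) Z i / r ^+ i).
  by rewrite ltr_pwDl// sumr_ge0// => i _; rewrite divr_ge0 ?exprn_ge0// ltW.
move=> n; rewrite {1 2}(divn_eq n k) exprD (le_trans (ZM _ _))//.
rewrite mulrCA; apply: ler_pM => //.
  have /le_trans : Z (n %/ k * k)%N <= Z k ^+ (n %/ k) by exact: submultiplicative_expn.
  by apply; rewrite mulnC exprM lerXn2r// nnegrE ?exprn_ge0// ltW.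
rewrite -ler_pdivrMr ?exprn_gt0//.
rewrite (bigD1 (Ordinal (ltn_pmod n k0)))//= addrCA lerDl.
by rewrite addr_ge0// sumr_ge0// => i _; rewrite divr_ge0 ?exprn_ge0// ltW.
Qed.

(** Fekete's lemma, with the lower bound c ensuring that the limit is positive. *)
Lemma submultiplicative_growth_rate Z c :
  (forall k l, Z (k + l)%N <= Z k * Z l) -> Z 0%N = 1 ->
  0 < c -> (forall n, c ^+ n <= Z n) ->
  growth_rate Z (limn (fun n => Z n `^ n%:R^-1)).
Proof.
move=> ZM Z1 c0 cZ.
have Zgt0 n : 0 < Z n by apply: lt_le_trans (cZ n); rewrite exprn_gt0.
have Z0 n : 0 <= Z n by exact: ltW.
pose u n := Z n `^ n%:R^-1.
have uX n : (0 < n)%N -> u n ^+ n = Z n.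
  move=> n0; rewrite /u -powR_mulrn ?powR_ge0// -powRrM mulVf ?powRr1//.
  by rewrite pnatr_eq0 -lt0n.
have u0 n : 0 <= u n by exact: powR_ge0.
have uP n r : (0 < n)%N -> 0 <= r -> (u n <= r) = (Z n <= r ^+ n).
  by move=> n0 r0; rewrite -(uX n n0) ler_pXn2r// nnegrE.
pose A : set R := [set u n | n in [set n | (0 < n)%N]].
have clA : lbound A c.
  move=> _ [n n0 <-]; by rewrite -(ler_pXn2r n0) ?nnegrE ?u0 ?(ltW c0)// uX.
have Ainf : has_inf A by split; [exists (u 1%N), 1%N|exists c].
have linf n : (0 < n)%N -> inf A <= u n.
  by move=> n0; apply: ge_inf; [exists c|exists n].
have cl : c <= inf A by apply: lb_le_inf => //; case: Ainf.
have upper r : inf A < r -> exists2 C, 0 < C & forall n, Z n <= C * r ^+ n.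
  move=> Ar; have [_ [k k0 <-] ukr] := inf_lt Ainf.1 Ar.
  have r0 : 0 < r by exact: le_lt_trans ukr.
  by apply: (@submultiplicative_upper _ k) => //; rewrite -uP ?ltW.
have u_cvg : u @ \oo --> inf A.
  apply/cvgrPdist_le => e e0.
  (* Geometric growth at the rate inf A + e absorbs the constant C. *)
  pose r := inf A + e / 2; have [|C C0 ZC] := upper r; first by rewrite /r; lra.
  have r0 : 0 < r by rewrite /r; lra.
  have re0 : 0 < inf A + e by lra.
  have q1 : `|r / (inf A + e)| < 1.
    by rewrite gtr0_norm ?divr_gt0// ltr_pdivrMr ?mul1r// /r; lra.
  have /cvgrPdist_lt/(_ C^-1) := cvg_expr q1.
  rewrite invr_gt0 => /(_ C0) near1; near=> n.
  have n0 : (0 < n)%N by near: n; exists 1%N.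
  have : `|0 - (r / (inf A + e)) ^+ n| < C^-1 by near: n.
  rewrite sub0r normrN gtr0_norm; last by rewrite exprn_gt0// divr_gt0.
  rewrite expr_div_n ltr_pdivrMr ?exprn_gt0// mulrC ltr_pdivlMr// mulrC => h.
  have : u n <= inf A + e by rewrite (uP n _ n0 (ltW re0)); apply: le_trans (ZC n) (ltW h).
  by have := linf n n0; rewrite ler_norml => ? ?; apply/andP; split; lra.
rewrite (cvg_lim _ u_cvg)//; split.
- exact: lt_le_trans cl.
- case=> [|n]; first by rewrite expr0 Z1.
  by rewrite -uX// lerXn2r// ?nnegrE// ?linf// (le_trans _ cl)// ltW.
- exact: upper.
Unshelve. all: by end_near.
Qed.

Lemma growth_rate_le Z Z' m m' K : growth_rate Z m -> growth_rate Z' m' ->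
  0 < K -> (forall n, Z n <= K ^+ n * Z' n) -> m <= K * m'.
Proof.
move=> [m0 mZ _] [m0' _ Zr'] K0 ZZ'; apply/ler_addgt0Pr => e e0.
have : m' < m' + e / K by rewrite ltrDl divr_gt0.
move=> /Zr'[C C0 ZC]; apply: (@expr_le_const _ _ C).
  by rewrite addr_gt0// mulr_gt0.
move=> n; apply: (le_trans (mZ n)); apply: (le_trans (ZZ' n)).
have -> : K * m' + e = K * (m' + e / K) by field; rewrite gt_eqF.
by rewrite exprMn mulrCA ler_wpM2l// exprn_ge0// ltW.
Qed.

(** Z is dominated by the sum of two sequences, of growth rates x m1 < m1 and y m0 < m1. *)
Lemma growth_rate_interpolate Z Z0 Z1 m m0 m1 x y :
  growth_rate Z m -> growth_rate Z0 m0 -> growth_rate Z1 m1 ->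
  0 < x < 1 -> 0 < y -> y * m0 < m1 ->
  (forall n, Z n <= x ^+ n * Z1 n + y ^+ n * Z0 n) -> m < m1.
Proof.
move=> [_ mZ _] [m00 _ Zr0] [m10 _ Zr1] /andP[x0 x1] y0 ym ZZ.
have [C1 C10 ZC1] : exists2 C, 0 < C & forall n, Z1 n <= C * (m1 * (1 + x) / (2 * x)) ^+ n.
  apply: Zr1; rewrite ltr_pdivlMr ?mulr_gt0//; nra.
have [C0 C00 ZC0] : exists2 C, 0 < C & forall n, Z0 n <= C * ((m1 + y * m0) / (2 * y)) ^+ n.
  by apply: Zr0; rewrite ltr_pdivlMr ?mulr_gt0//; nra.
pose a := m1 * (1 + x) / 2; pose b := (m1 + y * m0) / 2.
have a0 : 0 < a by rewrite /a divr_gt0// mulr_gt0// addr_gt0.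
have b0 : 0 < b by rewrite /b divr_gt0// addr_gt0// mulr_gt0.
have am : a < m1 by rewrite /a; nra.
have bm : b < m1 by rewrite /b; lra.
apply: (@le_lt_trans _ _ (Num.max a b)); last by rewrite gt_max am bm.
apply: (@expr_le_const _ _ (C1 + C0)); first by rewrite lt_max a0.
move=> n; apply: (le_trans (mZ n)); apply: (le_trans (ZZ n)).
rewrite mulrDl; apply: lerD.
  apply: (@le_trans _ _ (C1 * a ^+ n)).
    have -> : a = x * (m1 * (1 + x) / (2 * x)) by rewrite /a; field; rewrite gt_eqF.
    by rewrite exprMn mulrCA ler_wpM2l// exprn_ge0// ltW.
  by rewrite ler_wpM2l ?(ltW C10)// lerXn2r// ?nnegrE ?le_max ?lexx ?(ltW a0).
apply: (@le_trans _ _ (C0 * b ^+ n)).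
  have -> : b = y * ((m1 + y * m0) / (2 * y)) by rewrite /b; field; rewrite gt_eqF.
  by rewrite exprMn mulrCA ler_wpM2l// exprn_ge0// ltW.
by rewrite ler_wpM2l ?(ltW C00)// lerXn2r// ?nnegrE ?le_max ?lexx ?(ltW b0) ?orbT.
Qed.

(** Average the tangent inequality exp(v) >= exp(M) (1 + v - M), taken at the
barycentre M. *)
Lemma expR_convex (t a b : R) : 0 <= t <= 1 ->
  expR (t * a + (1 - t) * b) <= t * expR a + (1 - t) * expR b.
Proof.
move=> /andP[t0 t1]; set M := t * a + _.
have tangent v : expR M * (1 + (v - M)) <= expR v.
  have -> : expR v = expR M * expR (v - M) by rewrite -expRD addrC subrK.
  by rewrite ler_wpM2l ?expR_ge0 ?expR_ge1Dx.
have := ler_wpM2l t0 (tangent a).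
have := ler_wpM2l (_ : 0 <= 1 - t) (tangent b).
rewrite subr_ge0 => /(_ t1) hb ha; apply: le_trans (lerD ha hb).
by rewrite le_eqVlt; apply/orP; left; apply/eqP; rewrite /M; ring.
Qed.

End GrowthRate.

(** * Renewal sequences and a discrete Gronwall inequality *)

Section Renewal.
Variable R : realType.
Implicit Types (b i : nat -> R).

Lemma sum_triangle (F : nat -> nat -> R) N :
  \sum_(n < N) \sum_(k < n.+1) F k (n - k)%N =
  \sum_(k < N) \sum_(l < N - k) F k l.
Proof.
elim: N => [|N IH]; first by rewrite !big_ord0.
rewrite big_ord_recr /= IH [RHS]big_ord_recr /= big_ord_recr /=.
rewrite subnn subSnn big_ord1 addrA -big_split /=; congr (_ + _).
apply: eq_bigr => k _; rewrite subSn ?big_ord_recr//.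
exact/ltnW/ltn_ord.
Qed.

Lemma renewal_sum b i N : b 0%N = 1 ->
  (forall n, b n.+1 = \sum_(k < n.+1) i k.+1 * b (n - k)%N) ->
  \sum_(n < N.+1) b n = 1 + \sum_(k < N) i k.+1 * \sum_(l < N - k) b l.
Proof.
move=> b0 bS; rewrite big_ord_recl b0; congr (_ + _).
under eq_bigr do rewrite bS.
rewrite (sum_triangle (fun k l => i k.+1 * b l)).
by apply: eq_bigr => k _; rewrite mulr_sumr.
Qed.

Lemma ler_sum_ord b M N : (forall n, 0 <= b n) -> (M <= N)%N ->
  \sum_(n < M) b n <= \sum_(n < N) b n.
Proof.
move=> b0 MN; rewrite (big_ord_widen _ b MN) [leRHS](bigID (fun n : 'I_N => (n < M)%N)) /=.
by rewrite lerDl sumr_ge0.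
Qed.

(** If the i's summed to more than 1 over a window of length N, enlarging the
summation range of b by N + 1 would always add at least 1 to its sum. *)
Lemma renewal_bounded b i K : (forall n, 0 <= b n) -> (forall n, 0 <= i n) ->
  b 0%N = 1 -> (forall n, b n.+1 = \sum_(k < n.+1) i k.+1 * b (n - k)%N) ->
  (forall N, \sum_(n < N) b n <= K) ->
  forall N, \sum_(k < N) i k.+1 <= 1.
Proof.
move=> b_ge0 i_ge0 b0 bS bK N; rewrite leNgt; apply/negP => gt1.
have step L : 1 + \sum_(n < L) b n <= \sum_(n < (L + N).+1) b n.
  rewrite (renewal_sum _ b0 bS) lerD2l.
  apply: (@le_trans _ _ ((\sum_(k < N) i k.+1) * \sum_(n < L) b n)).
    by rewrite ler_peMl ?sumr_ge0// ltW.
  rewrite mulr_suml.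
  apply: (@le_trans _ _ (\sum_(k < N) i k.+1 * \sum_(l < L + N - k) b l)).
    apply: ler_sum => k _; apply: ler_wpM2l => //; apply: ler_sum_ord => //.
    by have := ltn_ord k; lia.
  apply: (@ler_sum_ord (fun k => i k.+1 * \sum_(l < L + N - k) b l)).
    by move=> k; rewrite mulr_ge0// sumr_ge0.
  exact: leq_addl.
have grow j : j%:R <= \sum_(n < j * N.+1) b n.
  elim: j => [|j IH]; first by rewrite mul0n big_ord0.
  rewrite -natr1 addrC; apply: (@le_trans _ _ (1 + \sum_(n < j * N.+1) b n)).
    by rewrite lerD2l.
  apply: (le_trans (step _)); rewrite mulSn addSn addnC; exact: lexx.
have := archi_boundP (le_trans (sumr_ge0 _ (fun _ _ => b_ge0 _)) (bK 0%N)).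
by rewrite ltNge (le_trans (grow _)).
Qed.

(** Summing the renewal equation gives B <= 1 + (1 - d) B. *)
Lemma renewal_subcritical b i d : (forall n, 0 <= b n) -> (forall n, 0 <= i n) ->
  b 0%N = 1 -> (forall n, b n.+1 = \sum_(k < n.+1) i k.+1 * b (n - k)%N) ->
  0 < d -> (forall N, \sum_(k < N) i k.+1 <= 1 - d) ->
  forall N, \sum_(n < N) b n <= d^-1.
Proof.
move=> b_ge0 i_ge0 b0 bS d0 id N; apply: (@le_trans _ _ (\sum_(n < N.+1) b n)).
  exact: ler_sum_ord.
set B := \sum_(n < N.+1) b n.
have B0 : 0 <= B by exact: sumr_ge0.
have : B <= 1 + (1 - d) * B.
  rewrite {1}/B (renewal_sum _ b0 bS) lerD2l.
  apply: (@le_trans _ _ ((\sum_(k < N) i k.+1) * B)); last by rewrite ler_wpM2r.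
  rewrite mulr_suml; apply: ler_sum => k _; apply: ler_wpM2l => //.
  by apply: ler_sum_ord => //; have := ltn_ord k; lia.
rewrite -[d^-1]mul1r ler_pdivlMr//; lra.
Qed.

Lemma convolution_sum_le (a h : nat -> R) (C E : R) N : 0 <= C ->
  (forall n, 0 <= h n) -> (forall L, \sum_(n < L) h n <= E) ->
  (forall n, (n < N)%N -> a n <= \sum_(k < n.+1) (C * h k.+1) * h (n - k)%N) ->
  \sum_(n < N) a n <= C * E * E.
Proof.
move=> C0 h0 hE aN.
apply: (@le_trans _ _ (\sum_(n < N) \sum_(k < n.+1) (C * h k.+1) * h (n - k)%N)).
  by apply: ler_sum => n _; exact: aN.
rewrite (sum_triangle (fun k l => C * h k.+1 * h l)).
apply: (@le_trans _ _ (\sum_(k < N) C * h k.+1 * E)).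
  by apply: ler_sum => k _; rewrite -mulr_sumr ler_wpM2l// mulr_ge0.
have E0 : 0 <= E by apply: le_trans (hE 0%N); rewrite big_ord0.
rewrite -mulr_suml -mulr_sumr ler_wpM2r// ler_wpM2l//.
apply: le_trans (hE N.+1); rewrite [leRHS]big_ord_recl lerDr.
exact: h0.
Qed.

Definition prod_below (items : seq (R * R)) (S : R) : R :=
  \prod_(a <- items | a.1 < S) (1 + a.2).

(** Group the terms of the expanded product by their item of largest key: each group
is the value of that item times the product over the items before it. The latter
may include items of the same key, whence an inequality. *)
Lemma prod_below_gronwall (items : seq (R * R)) S :
  (forall a, a \in items -> 0 <= a.2) ->
  1 + \sum_(a <- items | a.1 < S) a.2 * prod_below items a.1 <= prod_below items S.
Proof.
pose rel := fun a b : R * R => b.1 <= a.1.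
have ps := permEl (perm_sort rel items).
have relT : transitive rel by move=> b a c /= ab bc; exact: le_trans bc ab.
have so : sorted rel (sort rel items) by apply: sort_sorted => a b; exact: le_total.
have E T : prod_below items T = prod_below (sort rel items) T.
  by rewrite /prod_below (perm_big _ ps).
rewrite -(perm_big _ ps) /= E; under eq_bigr do rewrite E.
move=> pos; have {pos} : forall a, a \in sort rel items -> 0 <= a.2.
  by move=> a; rewrite mem_sort; exact: pos.
move: (sort rel items) so {E ps} => L; elim: L S => [|a L IH] S /=.
  by rewrite /prod_below !big_nil addr0.
rewrite path_sortedE// => /andP[/allP aL so] pos.
have posL u : u \in L -> 0 <= u.2 by move=> bL; apply: pos; rewrite inE bL orbT.
have a0 : 0 <= a.2 by apply: pos; rewrite mem_head.
have E u : u \in L -> prod_below (a :: L) u.1 = prod_below L u.1.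
  by move=> /aL; rewrite /rel /prod_below big_cons ltNge => ->.
have Ea : prod_below (a :: L) a.1 = prod_below L a.1 by rewrite /prod_below big_cons ltxx.
have {}IH T := IH T so posL.
have sumE T : \sum_(u <- L | u.1 < T) u.2 * prod_below (a :: L) u.1 =
    \sum_(u <- L | u.1 < T) u.2 * prod_below L u.1.
  rewrite big_seq_cond [RHS]big_seq_cond; apply: eq_bigr => b /andP[bL _].
  by rewrite E.
have pge0 T : 0 <= prod_below L T.
  rewrite /prod_below big_seq_cond; apply: prodr_ge0 => b /andP[bL _].
  by rewrite addr_ge0 ?posL.
rewrite big_cons sumE [leRHS]/prod_below big_cons -/(prod_below L S).
case: ifPn => aS; last exact: IH.
rewrite Ea mulrDl mul1r addrCA [leLHS]addrC; apply: lerD; first exact: IH.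
rewrite ler_wpM2l// /prod_below.
rewrite [leRHS](bigID (fun u => u.1 < a.1)) /=.
rewrite [X in _ <= X * _](eq_bigl (fun u => u.1 < a.1)) => [|b]; last first.
  by apply: andb_idl => ba; exact: lt_trans aS.
rewrite ler_peMr ?pge0//.
rewrite big_seq_cond; elim/big_ind : _ => // [x y x1 y1|b /andP[bL _]].
  by rewrite -[1]mulr1 ler_pM.
by rewrite lerDl posL.
Qed.

Lemma prod_below_ge1 (items : seq (R * R)) S :
  (forall a, a \in items -> 0 <= a.2) -> 1 <= prod_below items S.
Proof.
move=> pos; rewrite /prod_below big_seq_cond.
elim/big_ind : _ => // [x y x1 y1|b /andP[bL _]]; first by rewrite -[1]mulr1 ler_pM.
by rewrite lerDl pos.
Qed.

Lemma prod_below_le_expR (items : seq (R * R)) S :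
  (forall a, a \in items -> 0 <= a.2) ->
  prod_below items S <= expR (\sum_(a <- items) a.2).
Proof.
move=> pos; rewrite /prod_below; elim: items pos => [|a L IH] pos.
  by rewrite !big_nil expR0.
have posL u : u \in L -> 0 <= u.2 by move=> bL; apply: pos; rewrite inE bL orbT.
have a0 : 0 <= a.2 by apply: pos; rewrite mem_head.
rewrite !big_cons expRD; case: ifPn => _.
  apply: ler_pM; rewrite ?addr_ge0 ?IH ?expR_ge1Dx//.
  by apply: le_trans (prod_below_ge1 S posL).
apply: (le_trans (IH posL)); rewrite ler_peMl ?expR_ge0//.
by apply: le_trans (expR_ge1Dx _); rewrite lerDl.
Qed.

End Renewal.

(** * The growth rate as a function of the tilt *)

Section Criticality.
Variables (R : realType) (G : mgraph).
Hypotheses (G_connected : connected_graph G) (G_locfin : locally_finite G).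
Variable Gam : {pred aut G}.
Hypotheses (Gam_subgroup : group_closed Gam) (Gam_transitive : transitive_aut Gam).
Variables (o : vert G) (w : gpath G -> R).
Hypothesis w_good : good_weight Gam w.
Hypothesis Gam_nonunimodular : ~ unimodular R Gam.
Implicit Types (s : seq (edge G)) (c S lam z r : R).

Local Notation height := (@height R G Gam).
Local Notation tilt := (tilted_weight Gam w).
Local Notation walk_sum := (tilted_sum Gam o w).
Local Notation bridge := (@bridge R G Gam).
Local Notation irreducible_bridge := (@irreducible_bridge R G Gam).
Local Notation half_space := (@half_space R G Gam).
Local Notation mu := (mu_c Gam o w).

Lemma tilted_sum_mono lam (P Q : pred (seq (edge G))) n :
  (forall s, P s -> Q s) -> walk_sum lam P n <= walk_sum lam Q n.
Proof.
move=> PQ; rewrite /tilted_sum big_mkcond [leRHS]big_mkcond; apply: ler_sum => s _.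
case: ifPn => [/PQ ->//|_]; case: ifP => // _; exact: tilted_weight_ge0.
Qed.

Lemma tilted_weight_shift lam c s : tilt (lam + c) o s = tilt lam o s * expR (c * height s).
Proof. by rewrite /tilted_weight mulrDl expRD mulrA. Qed.

Lemma tilted_weight_le_shift lam c s : bridge c s -> tilt lam o s <= tilt (lam + c) o s.
Proof.
move=> bs; rewrite tilted_weight_shift ler_peMr ?tilted_weight_ge0//.
by apply: le_trans (expR_ge1Dx _); rewrite lerDl bridge_ge0.
Qed.

Lemma irreducible_sum_le_shift lam c n :
  walk_sum lam (irreducible_bridge c) n <= walk_sum (lam + c) (irreducible_bridge c) n.
Proof. by apply: ler_sum => s /and3P[_ bs _]; exact: tilted_weight_le_shift. Qed.

Lemma irreducible_bridge1 c (e : edge G) :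
  0 < c * edge_height R Gam e -> irreducible_bridge c [:: e].
Proof.
move=> he; apply/and3P; split => //.
  by apply/asboolP => -[|[|i]]//= _; rewrite height1 he lexx.
by apply/asboolP => -[|k].
Qed.

Lemma tilted_weight_edge_gt0 lam (e : edge G) : src e = o -> 0 < tilt lam o [:: e].
Proof.
move=> eo; rewrite mulr_gt0 ?expR_gt0// (lt_le_trans ltr01)//.
exact: (walk_weight_edge_ge1 w_good).
Qed.

Lemma edge_walk (e : edge G) : src e = o -> [:: e] \in walks o 1.
Proof. by move=> eo; rewrite (mem_walks G_locfin) /= eo eqxx. Qed.

Lemma irreducible_sum1_gt0 lam c : c != 0 ->
  0 < walk_sum lam (irreducible_bridge c) 1.
Proof.
move=> c0; have [e eo he] := exists_sloped_edge G_connected G_locfin Gam_subgroup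
  Gam_transitive o Gam_nonunimodular c0.
rewrite /tilted_sum (big_rem [:: e]) ?edge_walk//= irreducible_bridge1//.
rewrite ltr_wpDr ?tilted_weight_edge_gt0// sumr_ge0// => s _; exact: tilted_weight_ge0.
Qed.

(** A single sloped edge is an irreducible bridge, so changing the tilt has a
strict effect already at length 1. *)
Lemma irreducible_sum1_lt_shift lam c : c != 0 ->
  walk_sum lam (irreducible_bridge c) 1 < walk_sum (lam + c) (irreducible_bridge c) 1.
Proof.
move=> c0; have [e eo he] := exists_sloped_edge G_connected G_locfin Gam_subgroup
  Gam_transitive o Gam_nonunimodular c0.
rewrite /tilted_sum !(big_rem [:: e] (edge_walk eo)) /= irreducible_bridge1//.
apply: ltr_leD; last first.
  by apply: ler_sum => s /and3P[_ bs _]; exact: tilted_weight_le_shift.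
rewrite tilted_weight_shift ltr_pMr ?tilted_weight_edge_gt0// height1.
by apply: lt_le_trans (expR_ge1Dx _); rewrite ltrDl.
Qed.

(** Concatenations of ascending edges are self-avoiding, hence of weight at least 1;
the renewal equation says this at the level of sums. *)
Lemma tilted_sum_lower lam : exists2 c, 0 < c & forall n, c ^+ n <= walk_sum lam xpredT n.
Proof.
have c0 : 1 != 0 :> R by exact: oner_neq0.
exists (walk_sum lam (irreducible_bridge 1) 1); first exact: irreducible_sum1_gt0.
move=> n; apply: (@le_trans _ _ (walk_sum lam (bridge 1) n)); last exact: tilted_sum_mono.
elim: n => [|n IH].
  by rewrite expr0 (tilted_sum0 _ w_good) ?bridge_nil.
rewrite (bridge_renewal G_connected G_locfin Gam_subgroup Gam_transitive _ w_good).
rewrite big_ord_recl exprS subn0 -[leLHS]addr0; apply: lerD.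
  by rewrite ler_wpM2l ?tilted_sum_ge0.
by rewrite sumr_ge0// => k _; rewrite mulr_ge0 ?tilted_sum_ge0.
Qed.

Lemma mu_growth_rate lam : growth_rate (walk_sum lam xpredT) (mu lam).
Proof.
have [c c0 cZ] := tilted_sum_lower lam.
rewrite /mu_c (_ : (fun n => _) = (fun n => walk_sum lam xpredT n `^ n%:R^-1)).
  apply: submultiplicative_growth_rate c0 cZ.
    exact: (tilted_sumM_le G_connected G_locfin Gam_subgroup Gam_transitive).
  exact: tilted_sum0.
apply/funext => n.
by rewrite (Zsum_tilted_sum G_connected G_locfin Gam_subgroup).
Qed.

Lemma mu_gt0 lam : 0 < mu lam.
Proof. by case: (mu_growth_rate lam). Qed.

Lemma mu_lipschitz : exists2 M : R, 0 <= M &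
  forall lam lam', mu lam <= expR (M * `|lam - lam'|) * mu lam'.
Proof.
have [M M0 hM] := height_le_size R G_connected G_locfin Gam_subgroup Gam_transitive o.
exists M => // lam lam'.
apply: growth_rate_le (mu_growth_rate _) (mu_growth_rate _) (expR_gt0 _) _ => n.
rewrite /tilted_sum mulr_sumr big_seq [leRHS]big_seq; apply: ler_sum => s.
rewrite (mem_walks G_locfin) => /andP[ws /eqP sn].
rewrite /tilted_weight mulrCA ler_wpM2l ?(walk_weight_ge0 w_good)// -expRM_natl -expRD ler_expR.
rewrite -lerBlDr -mulrBl; apply: (le_trans (ler_norm _)).
rewrite normrM [leRHS](_ : _ = `|lam - lam'| * (M * n%:R)); last by ring.
rewrite ler_wpM2l//.
by rewrite -sn; exact: hM ws.
Qed.

Lemma mu_symm lam : mu (1 - lam) = mu lam.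
Proof.
have le l : mu (1 - l) <= mu l.
  rewrite -[leRHS]mul1r.
  apply: growth_rate_le (mu_growth_rate _) (mu_growth_rate _) ltr01 _ => n.
  by rewrite expr1n mul1r tilted_sum_symm.
have := le (1 - lam); rewrite subKr => ge_lam.
by apply: le_anti; apply/andP; split; [exact: (le lam)|exact: ge_lam].
Qed.

(** A scaled form of log-convexity in lam. The parameter k redistributes mass
exponentially in n between the two ends, and replaces the optimization behind
the Hoelder inequality. *)
Lemma tilted_sum_interpolate (t k lam0 lam1 : R) n : 0 <= t <= 1 ->
  walk_sum (t * lam1 + (1 - t) * lam0) xpredT n <=
  t * (expR (- (1 - t) * k) ^+ n * walk_sum lam1 xpredT n) +
  (1 - t) * (expR (t * k) ^+ n * walk_sum lam0 xpredT n).
Proof.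
move=> t01; rewrite /tilted_sum !mulr_sumr -big_split /=; apply: ler_sum => s _.
rewrite /tilted_weight !(mulrCA _ (walk_weight w o s)) -mulrDr ler_wpM2l ?(walk_weight_ge0 w_good)//.
rewrite -!expRM_natl -!expRD.
apply: le_trans (expR_convex _ _ t01); rewrite ler_expR le_eqVlt.
by apply/orP; left; apply/eqP; ring.
Qed.

Lemma mu_half_le lam : mu 2^-1 <= mu lam.
Proof.
rewrite -[leRHS]mul1r.
apply: growth_rate_le (mu_growth_rate _) (mu_growth_rate lam) ltr01 _ => n.
rewrite expr1n mul1r; have := @tilted_sum_interpolate 2^-1 0 (1 - lam) lam n.
rewrite !mulr0 expR0 expr1n !mul1r tilted_sum_symm//.
have -> : 2^-1 * lam + (1 - 2^-1) * (1 - lam) = 2^-1 :> R by field.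
move=> /(_ ltac:(lra)) /le_trans; apply.
by rewrite -mulrDl addrC subrK mul1r.
Qed.

Lemma mu_lt_interpolate (t : R) lam : mu 2^-1 < mu lam -> 0 <= t < 1 ->
  mu (t * lam + (1 - t) * 2^-1) < mu lam.
Proof.
move=> + /andP[t0 t1].
have := mu_growth_rate 2^-1; have := mu_growth_rate lam.
have := mu_growth_rate (t * lam + (1 - t) * 2^-1).
move: (mu 2^-1) (mu lam) (mu (_ + _)) => m0 m1 m rt r1 r0 m01.
have [m0_gt0 _ _] := r0; have [m1_gt0 _ _] := r1.
(* Half of the available room, so that exp(k) m0 < m1. *)
pose k : R := ln (m1 / m0) / 2.
have k0 : 0 < k by rewrite divr_gt0// ln_gt0// ltr_pdivlMr// mul1r.
apply: (growth_rate_interpolate (x := expR (- (1 - t) * k)) (y := expR (t * k)) rt r0 r1).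
- by rewrite expR_gt0 expR_lt1/= mulNr oppr_lt0 mulr_gt0// subr_gt0.
- exact: expR_gt0.
- rewrite -ltr_pdivlMr// -[ltRHS]lnK ?posrE ?divr_gt0// ltr_expR.
  have -> : ln (m1 / m0) = 2 * k by rewrite /k; field.
  by rewrite ltr_pM2r//; lra.
move=> n; apply: (le_trans (tilted_sum_interpolate k _ _ n _)); first by lra.
have Z0 l : 0 <= walk_sum l xpredT n by exact: tilted_sum_ge0.
by apply: lerD; rewrite ler_piMl ?mulr_ge0 ?exprn_ge0 ?expR_ge0//; lra.
Qed.

Lemma bernoulli (d : R) n : 0 <= d <= 1 -> 1 - n%:R * d <= (1 - d) ^+ n.
Proof.
move=> /andP[d0 d1]; elim: n => [|n IH]; first by rewrite expr0; lra.
rewrite exprS -natr1; apply: (@le_trans _ _ ((1 - d) * (1 - n%:R * d))).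
  by have : 0 <= n%:R :> R := ler0n _ _; nra.
by rewrite ler_wpM2l// subr_ge0.
Qed.

(** At the tilt 1/2 + c the bridges converge below 1/m, so irreducible bridges have
total mass at most 1 at 1/m, as a limit of subcritical values. Shifting back to the
tilt 1/2 strictly decreases that mass, and the renewal equation then bounds the
bridges at 1/m itself. *)
Lemma critical_bridges_bounded c (m : R) : c != 0 ->
  growth_rate (walk_sum (2^-1 + c) xpredT) m ->
  exists K, forall N, \sum_(n < N) m^-1 ^+ n * walk_sum 2^-1 (bridge c) n <= K.
Proof.
move=> c0 [m0 _ Zr]; set z := m^-1.
have z0 : 0 < z by rewrite invr_gt0.
pose b l x n := x ^+ n * walk_sum l (bridge c) n.
pose i l x n := x ^+ n * walk_sum l (irreducible_bridge c) n.
have b_ge0 l x n : 0 <= x -> 0 <= b l x n.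
  by move=> x0; rewrite mulr_ge0 ?exprn_ge0 ?tilted_sum_ge0.
have i_ge0 l x n : 0 <= x -> 0 <= i l x n.
  by move=> x0; rewrite mulr_ge0 ?exprn_ge0 ?tilted_sum_ge0.
have b0 l x : b l x 0%N = 1.
  by rewrite /b expr0 mul1r (tilted_sum0 _ w_good) ?bridge_nil.
have bS l x n : b l x n.+1 = \sum_(k < n.+1) i l x k.+1 * b l x (n - k)%N.
  rewrite /b (bridge_renewal G_connected G_locfin Gam_subgroup Gam_transitive _ w_good).
  rewrite mulr_sumr; apply: eq_bigr => k _; rewrite /i mulrACA -exprD.
  by congr (_ ^+ _ * _); have := ltn_ord k; lia.
(* Strictly below z, all bridges are dominated by the convergent series of Z. *)
have sub r N : 0 < r < 1 -> \sum_(k < N) i (2^-1 + c) (r * z) k.+1 <= 1.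
  move=> /andP[r0 r1]; have rz0 : 0 < r * z by rewrite mulr_gt0.
  have [|C C0 ZC] := Zr (m * (1 + r) / (2 * r)).
    by rewrite ltr_pdivlMr ?mulr_gt0//; nra.
  apply: (@renewal_bounded _ (b (2^-1 + c) (r * z)) _ (C * (1 - (1 + r) / 2)^-1)) => //.
  - by move=> n; apply: b_ge0; exact: ltW.
  - by move=> n; apply: i_ge0; exact: ltW.
  move=> {}N; apply: (@le_trans _ _ (\sum_(n < N) C * ((1 + r) / 2) ^+ n)).
    apply: ler_sum => n _; rewrite /b.
    have -> : (1 + r) / 2 = (r * z) * (m * (1 + r) / (2 * r)).
      by rewrite /z; field; rewrite !gt_eqF.
    rewrite [in leRHS]exprMn [leRHS]mulrCA ler_wpM2l ?exprn_ge0 ?(ltW rz0)//.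
    by apply: le_trans (ZC n); exact: tilted_sum_mono.
  rewrite -mulr_sumr ler_wpM2l ?(ltW C0)//.
  have q1 : (1 + r) / 2 != 1 by rewrite lt_eqF//; lra.
  have q0 : 0 < 1 - (1 + r) / 2 by lra.
  rewrite -[leRHS]mul1r ler_pdivlMr// mulrC.
  have := subrX1 ((1 + r) / 2) N; have : 0 <= ((1 + r) / 2) ^+ N by rewrite exprn_ge0//; lra.
  by move=> ? ?; nra.
(* The loss at r = 1 - d is at most a factor (1 - d)^N, with N fixed. *)
have crit N : \sum_(k < N) i (2^-1 + c) z k.+1 <= 1.
  set X := \sum_(k < N) _.
  have X0 : 0 <= X by apply: sumr_ge0 => k _; apply: i_ge0; exact: ltW.
  apply/ler_addgt0Pr => e e0.
  have NX : 0 <= N%:R * X by rewrite mulr_ge0.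
  pose d := Num.min 2^-1 (e / (N%:R * X + 1)).
  have d0 : 0 < d by rewrite lt_min divr_gt0//; lra.
  have d1 : d <= 2^-1 by rewrite ge_min lexx.
  have dX : d * (N%:R * X + 1) <= e.
    by rewrite -ler_pdivlMr ?ge_min ?lexx ?orbT//; lra.
  have := sub (1 - d) N ltac:(lra).
  suff : (1 - d) ^+ N * X <= \sum_(k < N) i (2^-1 + c) ((1 - d) * z) k.+1.
    have := @bernoulli d N ltac:(lra).
    have : 0 <= N%:R :> R by exact: ler0n.
    by move=> *; nra.
  rewrite mulr_sumr; apply: ler_sum => k _; rewrite /i exprMn -mulrA.
  rewrite ler_wpM2r ?i_ge0 ?(ltW z0)//.
  by apply: ler_wiXn2l; [lra|lra|exact: ltn_ord].
(* The gap between the two tilts, seen on bridges of length 1. *)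
pose d := i (2^-1 + c) z 1%N - i 2^-1 z 1%N.
have d0 : 0 < d.
  by rewrite subr_gt0 ltr_pM2l ?exprn_gt0// irreducible_sum1_lt_shift.
exists d^-1; apply: (@renewal_subcritical _ (b 2^-1 z) (i 2^-1 z)) => //.
- by move=> n; apply: b_ge0; exact: ltW.
- by move=> n; apply: i_ge0; exact: ltW.
move=> N; apply: (@le_trans _ _ (\sum_(k < N.+1) i 2^-1 z k.+1)).
  apply: (@ler_sum_ord _ (fun k => i 2^-1 z k.+1)) => // k.
  by apply: i_ge0; exact: ltW.
apply: (@le_trans _ _ (\sum_(k < N.+1) i (2^-1 + c) z k.+1 - d)); last by rewrite lerD2r.
rewrite lerBrDr big_ord_recl [leRHS]big_ord_recl /= addrAC.
apply: lerD; first by rewrite /d addrC subrK.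
apply: ler_sum => k _; apply: ler_wpM2l; first by rewrite exprn_ge0// ltW.
exact: irreducible_sum_le_shift.
Qed.

(** Peeling off the first bridge bounds half-space walks of span below S by a sum over
bridges b of height below S, times half-space walks, for the opposite sign, of span
below the height of b. Both signs are treated together by taking the bridges of
either sign as items of the Gronwall inequality. *)
Lemma half_space_bounded c z K : 0 < z ->
  (forall N, \sum_(n < N) z ^+ n * walk_sum 2^-1 (bridge c) n <= K) ->
  (forall N, \sum_(n < N) z ^+ n * walk_sum 2^-1 (bridge (- c)) n <= K) ->
  forall N S, \sum_(n < N) z ^+ n * walk_sum 2^-1 (half_space c S) n <= expR (K + K).
Proof.
move=> z0 Kp Km N S.
(* One item per bridge: its height is the key, its weight is the value. *)
pose items u := flatten [seq [seq (u * height s, z ^+ k.+1 * tilt 2^-1 o s) |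
   s <- walks o k.+1 & bridge u s] | k <- index_iota 0 N].
pose L := items c ++ items (- c).
have items_sum u (P : pred (R * R)) (f : R * R -> R) : \sum_(a <- items u | P a) f a =
    \sum_(k < N) \sum_(s <- walks o k.+1 | bridge u s && P (u * height s, z ^+ k.+1 * tilt 2^-1 o s))
      f (u * height s, z ^+ k.+1 * tilt 2^-1 o s).
  rewrite big_flatten big_map big_mkord.
  apply: eq_bigr => k _; rewrite big_map big_filter_cond.
  by [].
have L0 a : a \in L -> 0 <= a.2.
  have items0 u : a \in items u -> 0 <= a.2.
    move=> /flatten_mapP[k _ /mapP[s _ ->]] /=.
    by rewrite mulr_ge0 ?exprn_ge0 ?tilted_weight_ge0// ltW.
  by rewrite mem_cat => /orP[] /items0.
have LK : \sum_(a <- L) a.2 <= K + K.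
  rewrite big_cat /=; apply: lerD.
    apply: le_trans (Kp N.+1); rewrite items_sum big_ord_recl.
    rewrite ler_wpDl ?mulr_ge0 ?tilted_sum_ge0 ?exprn_ge0 ?(ltW z0)//.
    apply: ler_sum => k _; rewrite mulr_sumr.
    by under eq_bigl do rewrite andbT.
  apply: le_trans (Km N.+1); rewrite items_sum big_ord_recl.
  rewrite ler_wpDl ?mulr_ge0 ?tilted_sum_ge0 ?exprn_ge0 ?(ltW z0)//.
  apply: ler_sum => k _; rewrite mulr_sumr.
  by under eq_bigl do rewrite andbT.
have P0 T : 0 <= prod_below L T by apply: le_trans (prod_below_ge1 T L0).
suff H n : (n <= N)%N -> forall u T, u = c \/ u = - c ->
    \sum_(k < n) z ^+ k * walk_sum 2^-1 (half_space u T) k <= prod_below L T.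
  apply: (le_trans (H N (leqnn N) c S (or_introl erefl))).
  by apply: (le_trans (prod_below_le_expR S L0)); rewrite ler_expR.
elim: n => [|n IH] nN u T uc; first by rewrite big_ord0.
rewrite big_ord_recl expr0 mul1r (tilted_sum0 _ w_good); last first.
  by apply/asboolP => -[|i].
apply: le_trans (prod_below_gronwall T L0); rewrite lerD2l.
apply: (@le_trans _ _ (\sum_(a <- items u | a.1 < T) a.2 * prod_below L a.1)); last first.
  have pos v : 0 <= \sum_(a <- items v | a.1 < T) a.2 * prod_below L a.1.
    rewrite items_sum; apply: sumr_ge0 => k _; apply: sumr_ge0 => s _ /=.
    by rewrite mulr_ge0// mulr_ge0 ?exprn_ge0 ?tilted_weight_ge0// ltW.
  by case: uc => ->; rewrite big_cat /= ?lerDl ?lerDr.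
rewrite items_sum.
pose F k l := \sum_(s <- walks o k.+1 | bridge u s && (u * height s < T))
  z ^+ k.+1 * tilt 2^-1 o s *
    (z ^+ l * walk_sum 2^-1 (half_space (- u) (u * height s)) l).
apply: (@le_trans _ _ (\sum_(m < n) \sum_(k < m.+1) F k (m - k)%N)).
  apply: ler_sum => m _.
  have := half_space_sum_le G_connected G_locfin Gam_subgroup Gam_transitive o w_good 2^-1 u T m.
  move=> /(ler_wpM2l (exprn_ge0 m.+1 (ltW z0))) /le_trans; apply.
  rewrite mulr_sumr; apply: ler_sum => k _; rewrite mulr_sumr; apply: ler_sum => s _.
  rewrite mulrACA -exprD.
  by have -> : (k.+1 + (m - k) = m.+1)%N by have := ltn_ord k; lia.
rewrite sum_triangle.
apply: (@le_trans _ _ (\sum_(k < n) \sum_(s <- walks o k.+1 | bridge u s && (u * height s < T))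
  z ^+ k.+1 * tilt 2^-1 o s * prod_below L (u * height s))); last first.
  apply: (@ler_sum_ord _ (fun k => \sum_(s <- walks o k.+1 | bridge u s && (u * height s < T))
    z ^+ k.+1 * tilt 2^-1 o s * prod_below L (u * height s))); last exact: ltnW.
  move=> k; apply: sumr_ge0 => s _.
  by rewrite mulr_ge0// mulr_ge0 ?exprn_ge0 ?tilted_weight_ge0// ltW.
apply: ler_sum => k _; rewrite /F exchange_big /=; apply: ler_sum => s _.
rewrite -mulr_sumr; apply: ler_wpM2l.
  by apply: mulr_ge0; [exact/exprn_ge0/ltW|exact: tilted_weight_ge0].
apply: le_trans (IH (ltnW nN) (- u) (u * height s) _); last first.
  by case: uc => ->; rewrite ?opprK; [right|left].
apply: (@ler_sum_ord _ (fun l => z ^+ l * walk_sum 2^-1 (half_space (- u) (u * height s)) l)).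
  by move=> l; rewrite mulr_ge0 ?exprn_ge0 ?tilted_sum_ge0// ltW.
exact: leq_subr.
Qed.

Lemma half_space_mono c S S' s : S <= S' -> half_space c S s -> half_space c S' s.
Proof.
move=> SS /asboolP hs; apply/asboolP => i si.
by have /andP[-> /lt_le_trans ->] := hs i si.
Qed.

Lemma generating_term_ge0 lam z P n : 0 < z -> 0 <= z ^+ n * walk_sum lam P n.
Proof.
by move=> z0; apply: mulr_ge0; [exact/exprn_ge0/ltW|exact: tilted_sum_ge0].
Qed.

(** At z = 1 / mu(1/2) the partial sums of Z(1/2; n) z^n would be bounded, by the
Hammersley-Welsh decomposition, although each term is at least 1. *)
Lemma mu_half_lt lam : lam < 2^-1 -> mu 2^-1 < mu lam.
Proof.
move=> lamh; rewrite lt_neqAle mu_half_le andbT; apply/negP => /eqP mueq.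
pose c := 2^-1 - lam; have c0 : c != 0 by rewrite subr_eq0 gt_eqF.
have rate := mu_growth_rate 2^-1.
have ratep := mu_growth_rate (2^-1 + c).
have ratem := mu_growth_rate (2^-1 + - c).
have cp : 2^-1 + c = 1 - lam by rewrite /c; field.
have cm : 2^-1 + - c = lam by rewrite /c; ring.
rewrite [X in mu X]cp mu_symm -mueq in ratep.
rewrite [X in mu X]cm -mueq in ratem.
move: (mu 2^-1) rate ratep ratem => m rate ratep ratem {mueq}.
have [m0 mZ _] := rate.
pose z := m^-1; have z0 : 0 < z by rewrite invr_gt0.
have zm : z * m = 1 by exact: mulVf (lt0r_neq0 m0).
have [K1 hK1] := critical_bridges_bounded c0 ratep.
have [|K2 hK2] := critical_bridges_bounded _ ratem; first by rewrite oppr_eq0.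
pose K := Num.max K1 K2.
have H := @half_space_bounded c z K z0.
have {}H : forall N S, \sum_(n < N) z ^+ n * walk_sum 2^-1 (half_space c S) n <= expR (K + K).
  by apply: H => N; rewrite /K le_max ?hK1 ?hK2 ?orbT.
have [M M0 hM] := height_le_size R G_connected G_locfin Gam_subgroup Gam_transitive o.
have [C C0 hC] := weak_half_space_sum_le G_connected G_locfin Gam_subgroup
  Gam_transitive o w_good Gam_nonunimodular c0.
pose E := expR (K + K).
(* The span bound S exceeds every height that walks of length N can reach; the
   bound on half-space walks does not depend on it. *)
have up N : \sum_(n < N) z ^+ n * walk_sum 2^-1 xpredT n <= C / z * E * E.
  pose S := `|c| * (M * N%:R) + 1.
  pose h n := z ^+ n * walk_sum 2^-1 (half_space c S) n.
  have SS n : (n <= N)%N -> `|c| * (M * n%:R) + 1 <= S.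
    move=> nN; rewrite /S lerD2r; apply: (ler_wpM2l (normr_ge0 c)).
    by apply: (ler_wpM2l M0); rewrite ler_nat.
  apply: (@convolution_sum_le _ (fun n => z ^+ n * walk_sum 2^-1 xpredT n) h (C / z) E).
  - exact: divr_ge0 (ltW C0) (ltW z0).
  - by move=> n; exact: generating_term_ge0.
  - by move=> L; exact: H.
  move=> n nN; have zX k : 0 <= z ^+ k := exprn_ge0 k (ltW z0).
  have := tilted_sum_le_half_space G_connected G_locfin Gam_subgroup Gam_transitive
    o w_good n c0 M0 hM.
  move=> /(ler_wpM2l (zX n)) /le_trans; apply.
  rewrite mulr_sumr; apply: ler_sum => k _.
  have kn := ltn_ord k.
  have -> : z ^+ n = z ^+ k * z ^+ (n - k) by rewrite -exprD; congr (_ ^+ _); lia.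
  rewrite mulrACA; apply: ler_pM.
  - exact: generating_term_ge0.
  - exact: generating_term_ge0.
  - have -> : C / z * h k.+1 = z ^+ k * (C * walk_sum 2^-1 (half_space c S) k.+1).
      by rewrite /h exprS; field; rewrite gt_eqF.
    apply: (ler_wpM2l (zX k)); apply: (le_trans (hC M k M0 hM)).
    apply: (ler_wpM2l (ltW C0)); apply: tilted_sum_mono => s.
    by apply: half_space_mono; apply: SS; lia.
  apply: (ler_wpM2l (zX (n - k)%N)); apply: tilted_sum_mono => s.
  by apply: half_space_mono; apply: SS; lia.
have low N : N%:R <= \sum_(n < N) z ^+ n * walk_sum 2^-1 xpredT n.
  rewrite -[N in N%:R]card_ord -sumr_const; apply: ler_sum => n _.
  apply: (@le_trans _ _ (z ^+ n * m ^+ n)); last by rewrite ler_wpM2l ?exprn_ge0 ?(ltW z0).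
  by rewrite -exprMn zm expr1n lexx.
have := archi_boundP (le_trans (ler0n _ _) (le_trans (low 0%N) (up 0%N))).
by rewrite ltNge (le_trans (low _)).
Qed.

(** The point lam2 lies between lam1 and 1/2, so that interpolation applies. *)
Lemma mu_decreasing lam1 lam2 : lam1 < lam2 -> lam2 <= 2^-1 -> mu lam2 < mu lam1.
Proof.
move=> l12 l2h; have l1h : lam1 < 2^-1 by exact: lt_le_trans l2h.
pose t : R := (2^-1 - lam2) / (2^-1 - lam1).
have d0 : 0 < 2^-1 - lam1 by rewrite subr_gt0.
have -> : lam2 = t * lam1 + (1 - t) * 2^-1.
  by rewrite /t; field; rewrite gt_eqF//; lra.
apply: mu_lt_interpolate; first exact: mu_half_lt.
by rewrite divr_ge0 ?subr_ge0 ?(ltW l1h)//= ltr_pdivrMr// mul1r; lra.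
Qed.

Lemma z_c_continuous : continuous (z_c Gam o w).
Proof.
have [M M0 hM] := mu_lipschitz; move=> lam.
have cvg0 (k : R) : k * (M * `|x - lam|) @[x --> lam] --> (0 : R).
  have -> : 0 = k * (M * `|lam - lam|) by rewrite subrr normr0 !mulr0.
  apply: cvgMr; apply: cvgMr; apply: cvg_norm; apply: cvgB; first exact: cvg_id.
  exact: cvg_cst.
have cvg1 (k : R) :
    expR (k * (M * `|x - lam|)) * z_c Gam o w lam @[x --> lam] --> z_c Gam o w lam.
  rewrite -[X in _ --> X]mul1r -(@expR0 R); apply: cvgM; last exact: cvg_cst.
  apply: (cvg_comp (fun x => k * (M * `|x - lam|)) expR (cvg0 k)).
  exact: continuous_expR.
apply: (squeeze_cvgr _ (cvg1 (- 1)) (cvg1 1)); near=> x.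
have m0 := mu_gt0 lam; have mx := mu_gt0 x.
have h1 := hM lam x; have h2 := hM x lam; rewrite distrC in h1.
rewrite /z_c mulN1r mul1r expRN.
have E0 := expR_gt0 (M * `|x - lam|).
move: (mu lam) (mu x) (expR _) m0 mx E0 h1 h2 => a b E a0 b0 E0 ab ba.
apply/andP; split.
  by rewrite -invfM lef_pV2 ?posrE ?mulr_gt0.
by rewrite ler_pdivlMr// mulrC ler_pdivrMr.
Unshelve. all: by end_near.
Qed.

End Criticality.

Theorem theorem1p8 (R : realType) (G : mgraph)
    (G_connected : connected_graph G) (G_locfin : locally_finite G)
    (Gam : {pred aut G}) (Gam_subgroup : group_closed Gam)
    (Gam_transitive : transitive_aut Gam)
    (Gam_nonunimodular : ~ unimodular R Gam)
    (o : vert G) (w : gpath G -> R) (w_good : good_weight Gam w) :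
  [/\ forall lam : R, 0 < z_c Gam o w lam <= z_t Gam o w,
      continuous (z_c Gam o w) &
      {in `]-oo, 2^-1] &, {homo z_c Gam o w : lam1 lam2 / lam1 < lam2}}].
Proof.
have mu_gt0 := mu_gt0 G_connected G_locfin Gam_subgroup Gam_transitive o w_good
  Gam_nonunimodular.
split.
- move=> lam; rewrite /z_t /z_c invr_gt0 mu_gt0 lef_pV2 ?posrE ?mu_gt0//.
  exact: mu_half_le.
- exact: z_c_continuous.
move=> lam1 lam2 _; rewrite in_itv /= => lam2h l12.
rewrite /z_c ltf_pV2 ?posrE ?mu_gt0//.
exact: mu_decreasing.
Qed.
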